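(* Consider a solution of the Riemann problem for the compressible Euler equations with composite equation of state $p=p_{\mathrm h}(\rho,e_{\mathrm h})+p_{\mathrm b}(\rho)$ and initial states $W^L=[\rho^L,u^L,p^L]$ (left) and $W^R=[\rho^R,u^R,p^R]$ (right), in the setting and under the standing assumptions described in the context, and let $\lambda_1^-$ and $\lambda_3^+$ be its leftmost and rightmost wave speeds. Assume that the left and the right wave are each either compressive or expansive (each may be elementary or composite). Let $\overline q^L,\overline q^R,\underline q^L,\underline q^R$ be the unique solutions (assumed to exist) of $$f^S_{\mathrm h}(\overline q^L;W^L)=\max(u^L-u^R,0)=f^S_{\mathrm h}(\overline q^R;W^R),\qquad f^S_{\mathrm h}(\underline q^L;W^L)=\min(u^L-u^R,0)=f^S_{\mathrm h}(\underline q^R;W^R),$$ so that $\underline q^L\le p_{\mathrm h}^L\le\overline q^L$ and $\underline q^R\le p_{\mathrm h}^R\le\overline q^R$. Set $$\overline p_{\mathrm h}^{*L}:=\max\{\overline q^L,\;p^R-\hat p_{\mathrm b}(v^L)\},\qquad \overline p_{\mathrm h}^{*R}:=\max\{\overline q^R,\;p^L-\hat p_{\mathrm b}(v^R)\},$$ $$\underline p_{\mathrm h}^{*L}:=\min\{\underline q^L,\;p^R-\hat p_{\mathrm b}(v^L)\},\qquad \underline p_{\mathrm h}^{*R}:=\min\{\underline q^R,\;p^L-\hat p_{\mathrm b}(v^R)\},$$ let $\overline v^{*L}:=\xi_{\mathrm h}(\overline p_{\mathrm h}^{*L};W^L)$, $\overline v^{*R}:=\xi_{\mathrm h}(\overline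 p_{\mathrm h}^{*R};W^R)$, $\underline v^{*L}:=\xi_{\mathrm h}(\underline p_{\mathrm h}^{*L};W^L)$, $\underline v^{*R}:=\xi_{\mathrm h}(\underline p_{\mathrm h}^{*R};W^R)$, so that $\overline v^{*L}\le v^L\le\underline v^{*L}$ and $\overline v^{*R}\le v^R\le\underline v^{*R}$, and let $$\overline\lambda^-_{1,\mathrm h}:=u^L-v^L\,Q_{\mathrm h}(\overline p_{\mathrm h}^{*L};W^L),\qquad \overline\lambda^+_{3,\mathrm h}:=u^R+v^R\,Q_{\mathrm h}(\overline p_{\mathrm h}^{*R};W^R).$$ Then $$\lambda_1^-\;\ge\;u^L-\sqrt{\big(u^L-\overline\lambda^-_{1,\mathrm h}\big)^2+2(v^L)^2\max_{\overline v^{*L}\le\tau\le\underline v^{*L}}\frac{\hat a_{\mathrm b}^2(\tau)}{\tau^2}},$$ $$\lambda_3^+\;\le\;u^R+\sqrt{\big(\overline\lambda^+_{3,\mathrm h}-u^R\big)^2+2(v^R)^2\max_{\overline v^{*R}\le\tau\le\underline v^{*R}}\frac{\hat a_{\mathrm b}^2(\tau)}{\tau^2}}.$$ No case distinction on the type (shock or rarefaction fan) of the outermost elementary wave of either family is necessary.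
   Context: Equation of state. $v=1/\rho$ is the specific volume; a hat marks a quantity expressed as a function of $v$. The total pressure is $p=p_{\mathrm h}(\rho,e_{\mathrm h})+p_{\mathrm b}(\rho)$; $p_{\mathrm h}$ is a complete equation of state in density and specific internal energy $e_{\mathrm h}$, with specific entropy $s_{\mathrm h}$ and sound speed $a_{\mathrm h}$; $p_{\mathrm b}(\rho)=\rho^2\partial_\rho e_{\mathrm b}(\rho)$, i.e. $\hat e_{\mathrm b}'(v)=-\hat p_{\mathrm b}(v)$. $\hat e_{\mathrm h}(v,p_{\mathrm h})$ is $e_{\mathrm h}$ as a function of $v$ and $p_{\mathrm h}$. Standing assumptions (constants $p_\infty,q\in\mathbb R$): (A.0) $p_{\mathrm h}>-p_\infty$, $a_{\mathrm h}^2=-v^2\partial_v\hat p_{\mathrm h}|_{s_{\mathrm h}}>0$, $\partial_v^2\hat p_{\mathrm h}|_{s_{\mathrm h}}>0$; (A.1) $\partial_v\hat e_{\mathrm h}|_{p_{\mathrm h}}\ge p_\infty$, $\partial_{p_{\mathrm h}}\hat e_{\mathrm h}|_v\ge0$, $\partial_{s_{\mathrm h}}\hat p_{\mathrm h}|_v>0$, $\hat e_{\mathrm h}\ge q$, $\lim_{v\to0+}\hat e_{\mathrm h}(v,p_{\mathrm h})=q$; (A.2) $e_{\mathrm b}$ is $C^3$ and $a_{\mathrm b}^2(\rho):=\partial_\rho p_{\mathrm b}(\rho)\ge0$, i.e. $\hat a_{\mathrm b}^2(v)=-v^2\hat p_{\mathrm b}'(v)\ge0$. The Riemann problem for the hydrodynamical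 equation of state alone is assumed uniquely solvable with the classical structure. States. $W=[\rho,u,p]$ has specific volume $v$, velocity $u$, total pressure $p$ and hydrodynamical pressure $p_{\mathrm h}=p-\hat p_{\mathrm b}(v)$; superscripts label the state. Hydrodynamical shock functions. For a state $W$, $\tilde v=\xi_{\mathrm h}(P;W)$ denotes the solution of $\hat e_{\mathrm h}(\tilde v,P)-\hat e_{\mathrm h}(v,p_{\mathrm h})+\tfrac12(P+p_{\mathrm h})(\tilde v-v)=0$, for $P$ on both sides of $p_{\mathrm h}$; it is strictly decreasing in $P$ with $\xi_{\mathrm h}(p_{\mathrm h};W)=v$. Set $f^S_{\mathrm h}(P;W)=\mathrm{sgn}(P-p_{\mathrm h})\,|P-p_{\mathrm h}|^{1/2}|v-\xi_{\mathrm h}(P;W)|^{1/2}$ (strictly increasing in $P$) and $Q_{\mathrm h}(P;W)=\big(|P-p_{\mathrm h}|/|v-\xi_{\mathrm h}(P;W)|\big)^{1/2}$ (as a limit at $P=p_{\mathrm h}$). Waves. The Euler system is $\partial_t\rho+\partial_x(\rho u)=0$, $\partial_t(\rho u)+\partial_x(\rho u^2+p)=0$, $\partial_t\mathcal E+\partial_x(u(\mathcal E+p))=0$, $\mathcal E=\tfrac12\rho u^2+\rho(e_{\mathrm h}+e_{\mathrm b})$. A left wave from $W^L$ to $W^{*L}$ is a finite sequence $W^L=W^{(0)},\dots,W^{(n)}=W^{*L}$, $n\ge1$, consecutive states being connected by an elementary left-facing wave, with speeds of consecutive waves ordered so that the self-similar profile is well defined. Elementary waves from $W^-$ to $W^+$: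 (i) a shock: $\hat e_{\mathrm h}(v^+,p^+_{\mathrm h})-\hat e_{\mathrm h}(v^-,p^-_{\mathrm h})+\tfrac12(p_{\mathrm h}^++p_{\mathrm h}^-)(v^+-v^-)+\hat A_{\mathrm b}(v^+,v^-)=0$, where $\hat A_{\mathrm b}(w,v)=\hat e_{\mathrm b}(w)-\hat e_{\mathrm b}(v)+\tfrac12(\hat p_{\mathrm b}(w)+\hat p_{\mathrm b}(v))(w-v)$, with $u^+=u^--f^S$, $f^S=\pm|p^+-p^-|^{1/2}|v^--v^+|^{1/2}$ ($+$ if $p^+\ge p^-$, $-$ otherwise), and speed $\sigma(W^-,W^+)=u^--v^-Q$, $Q=(|p^+-p^-|/|v^--v^+|)^{1/2}$; (ii) a rarefaction fan: $s_{\mathrm h}$ constant, $u^+=u^--f^R$, $f^R=\int_{\rho^-}^{\rho^+}\rho^{-1}\sqrt{a_{\mathrm h}^2+a_{\mathrm b}^2}\,|_{s_{\mathrm h}}\,d\rho$, with characteristic speed $\lambda(W)=u-\sqrt{a_{\mathrm h}^2+a_{\mathrm b}^2}$. The wave is compressive if $p_{\mathrm h}^{(k)}$ is non-decreasing and $v^{(k)}$ non-increasing in $k$; expansive if $p_{\mathrm h}^{(k)}$ is non-increasing and $v^{(k)}$ non-decreasing in $k$. The wave is elementary if $n=1$. Standing assumptions on the wave: (A.3) $\mathcal G:=v^3(\partial_v^2\hat p_{\mathrm h}|_{s_{\mathrm h}}+\hat p_{\mathrm b}'')/(2(a_{\mathrm h}^2+a_{\mathrm b}^2))\ne0$ along each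 fan; (A.4) for each shock $W^{(k-1)}\to W^{(k)}$ and every $W$ on the Hugoniot locus between them, $\sigma(W^{(k-1)},W)\ge\sigma(W^{(k-1)},W^{(k)})$; (A.5) a shock adjacent to a fan at $W^{(k)}$ travels at speed $\lambda(W^{(k)})$. Right waves from $W^R$ to $W^{*R}$ are the mirror images under $(x,u)\mapsto(-x,-u)$ (so $u^+=u^-+f$, speeds $u+vQ$, $u+\sqrt{a_{\mathrm h}^2+a_{\mathrm b}^2}$). A Riemann solution consists of a left wave from $W^L$ to $W^{*L}$, a contact discontinuity between $W^{*L}$ and $W^{*R}$ with equal velocities and equal total pressures, and a right wave from $W^R$ to $W^{*R}$. $\lambda_1^-$ (resp. $\lambda_3^+$) is the speed of the outer edge of the outermost elementary wave of the left (resp. right) wave: the shock speed, or the characteristic speed at $W^L$ (resp. $W^R$) for a fan. *)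

(* Defs.v *)
From Stdlib Require Export Reals.
From Coquelicot Require Export Coquelicot.
Open Scope R_scope.

(** [p_h] and [s_h] take density and specific internal energy.  The hatted
    functions are tied to them by [complete_eos]; like every Rocq function they
    are total, but they only matter on the admissible range [0 < v],
    [- p_inf < P]. *)
Record eos := Eos {
  p_inf : R;
  q_ref : R;
  p_h : R -> R -> R;       (* rho, e_h *)
  s_h : R -> R -> R;       (* rho, e_h *)
  e_hat : R -> R -> R;     (* v, p_h *)
  p_hat : R -> R -> R;     (* v, s_h *)
  e_b : R -> R             (* rho *)
}.

Definition hydro_part (E : eos) : eos :=
  Eos (p_inf E) (q_ref E) (p_h E) (s_h E) (e_hat E) (p_hat E) (fun _ => 0).

Definition s_hat (E : eos) (v P : R) : R := s_h E (/ v) (e_hat E v P).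

Definition p_b (E : eos) (rho : R) : R := rho ^ 2 * Derive (e_b E) rho.
Definition a_b2 (E : eos) (rho : R) : R := Derive (p_b E) rho.

Definition e_b_hat (E : eos) (v : R) : R := e_b E (/ v).
Definition p_b_hat (E : eos) (v : R) : R := p_b E (/ v).
Definition a_b2_hat (E : eos) (v : R) : R := a_b2 E (/ v).

Definition a_h2 (E : eos) (v s : R) : R :=
  - v ^ 2 * Derive (fun w => p_hat E w s) v.

Definition c2 (E : eos) (v s : R) : R := a_h2 E v s + a_b2_hat E v.

Definition G_fund (E : eos) (v s : R) : R :=
  v ^ 3 * (Derive_n (fun w => p_hat E w s) 2 v + Derive_n (p_b_hat E) 2 v)
  / (2 * c2 E v s).

Definition A_b (E : eos) (w v : R) : R :=
  e_b_hat E w - e_b_hat E v + / 2 * (p_b_hat E w + p_b_hat E v) * (w - v).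

(** The two [gibbs] clauses are [T ds = de + p dv] with [1/T = ds/de > 0],
    written in the variables [(rho, e)]. *)
Record complete_eos (E : eos) : Prop := {
  e_hat_section : forall v P, 0 < v -> - p_inf E < P ->
    p_h E (/ v) (e_hat E v P) = P;
  e_hat_retract : forall rho e, 0 < rho -> - p_inf E < p_h E rho e ->
    e_hat E (/ rho) (p_h E rho e) = e;
  p_hat_isentrope : forall rho e, 0 < rho -> - p_inf E < p_h E rho e ->
    p_hat E (/ rho) (s_h E rho e) = p_h E rho e;
  gibbs_temperature : forall rho e, 0 < rho -> - p_inf E < p_h E rho e ->
    0 < Derive (fun e' => s_h E rho e') e;
  gibbs_pressure : forall rho e, 0 < rho -> - p_inf E < p_h E rho e ->
    Derive (fun r => s_h E r e) rho
    = - (p_h E rho e / rho ^ 2) * Derive (fun e' => s_h E rho e') e;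
  p_h_C2 : forall rho e, 0 < rho -> - p_inf E < p_h E rho e ->
    ex_diff_n (p_h E) 2 rho e;
  s_h_C2 : forall rho e, 0 < rho -> - p_inf E < p_h E rho e ->
    ex_diff_n (s_h E) 2 rho e;
  e_hat_C2 : forall v P, 0 < v -> - p_inf E < P ->
    ex_diff_n (e_hat E) 2 v P;
  p_hat_C2 : forall v P, 0 < v -> - p_inf E < P ->
    ex_diff_n (p_hat E) 2 v (s_hat E v P)
}.

(** The restriction [- p_inf < p_h] is the range of [P] here and part
    of [admissible] below. *)
Definition hydro_convexity (E : eos) : Prop :=
  forall v P, 0 < v -> - p_inf E < P ->
    0 < a_h2 E v (s_hat E v P) /\
    0 < Derive_n (fun w => p_hat E w (s_hat E v P)) 2 v.

Definition hydro_energy (E : eos) : Prop :=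
  forall v P, 0 < v -> - p_inf E < P ->
    p_inf E <= Derive (fun w => e_hat E w P) v /\
    0 <= Derive (fun P' => e_hat E v P') P /\
    0 < Derive (fun s => p_hat E v s) (s_hat E v P) /\
    q_ref E <= e_hat E v P /\
    filterlim (fun w => e_hat E w P) (at_right 0) (locally (q_ref E)).

Definition binding_eos (E : eos) : Prop :=
  forall rho, 0 < rho ->
    (forall k, (k <= 3)%nat -> ex_derive_n (e_b E) k rho) /\
    continuous (Derive_n (e_b E) 3) rho /\
    0 <= a_b2 E rho.

Record state := State { rho : R; vel : R; pres : R }.

Definition vol (W : state) : R := / rho W.
Definition ph (E : eos) (W : state) : R := pres W - p_b_hat E (vol W).
Definition eh (E : eos) (W : state) : R := e_hat E (vol W) (ph E W).
Definition sh (E : eos) (W : state) : R := s_hat E (vol W) (ph E W).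

Definition admissible (E : eos) (W : state) : Prop :=
  0 < rho W /\ - p_inf E < ph E W.

Definition mirror (W : state) : state := State (rho W) (- vel W) (pres W).

(** [iota] is definite description; meaningful for [- p_inf E < P]. *)
Definition xi_h (E : eos) (P : R) (W : state) : R :=
  iota (fun w : R => 0 < w /\
    e_hat E w P - eh E W + / 2 * (P + ph E W) * (w - vol W) = 0).

Definition f_S_h (E : eos) (P : R) (W : state) : R :=
  sign (P - ph E W) * sqrt (Rabs (P - ph E W))
  * sqrt (Rabs (vol W - xi_h E P W)).

Definition Q_h (E : eos) (P : R) (W : state) : R :=
  let Q P' := sqrt (Rabs (P' - ph E W) / Rabs (vol W - xi_h E P' W)) in
  if Req_EM_T P (ph E W) then real (Lim Q (ph E W)) else Q P.

Definition xi_h_decreasing (E : eos) : Prop :=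
  forall W, admissible E W ->
  forall P P', - p_inf E < P -> P < P' -> xi_h E P' W < xi_h E P W.

Definition between (a b x : R) : Prop := Rmin a b <= x <= Rmax a b.

Definition f_S (W0 W1 : state) : R :=
  (if Rle_dec (pres W0) (pres W1) then 1 else -1)
  * (sqrt (Rabs (pres W1 - pres W0)) * sqrt (Rabs (vol W0 - vol W1))).

Definition Q_S (W0 W1 : state) : R :=
  sqrt (Rabs (pres W1 - pres W0) / Rabs (vol W0 - vol W1)).

Definition sigma (W0 W1 : state) : R := vel W0 - vol W0 * Q_S W0 W1.

Definition lambda (E : eos) (W : state) : R :=
  vel W - sqrt (c2 E (vol W) (sh E W)).

Definition hugoniot (E : eos) (W0 W1 : state) : Prop :=
  eh E W1 - eh E W0 + / 2 * (ph E W1 + ph E W0) * (vol W1 - vol W0)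
    + A_b E (vol W1) (vol W0) = 0 /\
  vel W1 = vel W0 - f_S W0 W1.

(** [sigma] is only defined for a nontrivial jump. *)
Definition shock (E : eos) (W0 W1 : state) : Prop :=
  vol W1 <> vol W0 /\ hugoniot E W0 W1.

Definition fan_vel (E : eos) (W0 : state) (r : R) : R :=
  vel W0
  - RInt (fun x => / x * sqrt (c2 E (/ x) (sh E W0))) (rho W0) r.

(** The third clause says that the isentrope stays admissible throughout the
    fan, the last that the characteristic speed does not decrease from [W0] to
    [W1], so that the fan has a self-similar profile.  [rho W0 = rho W1] gives
    a wave of zero strength. *)
Definition fan (E : eos) (W0 W1 : state) : Prop :=
  sh E W1 = sh E W0 /\
  vel W1 = fan_vel E W0 (rho W1) /\
  (forall r, between (rho W0) (rho W1) r ->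
     exists P, - p_inf E < P /\ s_hat E (/ r) P = sh E W0) /\
  (forall r r', between (rho W0) (rho W1) r' -> between (rho W0) r' r ->
     fan_vel E W0 r - sqrt (c2 E (/ r) (sh E W0))
     <= fan_vel E W0 r' - sqrt (c2 E (/ r') (sh E W0))).

Definition fan_nonlinearity (E : eos) (W0 W1 : state) : Prop :=
  forall r, between (rho W0) (rho W1) r -> G_fund E (/ r) (sh E W0) <> 0.

Definition liu_condition (E : eos) (W0 W1 : state) : Prop :=
  forall W, admissible E W -> shock E W0 W ->
    between (vol W0) (vol W1) (vol W) ->
    between (ph E W0) (ph E W1) (ph E W) ->
    sigma W0 W1 <= sigma W0 W.

Inductive wave_kind := Shock | Fan.

(** [kind k] is the type of the elementary wave from [st k] to [st (S k)], for
    [k < len]; values beyond that range are irrelevant. *)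
Record wave := Wave { len : nat; st : nat -> state; kind : nat -> wave_kind }.

Definition mirror_wave (w : wave) : wave :=
  Wave (len w) (fun k => mirror (st w k)) (kind w).

Definition head_speed (E : eos) (w : wave) (k : nat) : R :=
  match kind w k with
  | Shock => sigma (st w k) (st w (S k))
  | Fan => lambda E (st w k)
  end.

Definition tail_speed (E : eos) (w : wave) (k : nat) : R :=
  match kind w k with
  | Shock => sigma (st w k) (st w (S k))
  | Fan => lambda E (st w (S k))
  end.

Definition sonic_junctions (E : eos) (w : wave) : Prop :=
  forall k, (S k < len w)%nat ->
    (kind w k = Shock -> kind w (S k) = Fan ->
       sigma (st w k) (st w (S k)) = lambda E (st w (S k))) /\
    (kind w k = Fan -> kind w (S k) = Shock ->
       sigma (st w (S k)) (st w (S (S k))) = lambda E (st w (S k))).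

Record left_wave (E : eos) (w : wave) (W Wstar : state) : Prop := {
  lw_len : (1 <= len w)%nat;
  lw_first : st w 0 = W;
  lw_last : st w (len w) = Wstar;
  lw_admissible : forall k, (k <= len w)%nat -> admissible E (st w k);
  lw_shock : forall k, (k < len w)%nat -> kind w k = Shock ->
    shock E (st w k) (st w (S k)) /\ liu_condition E (st w k) (st w (S k));
  lw_fan : forall k, (k < len w)%nat -> kind w k = Fan ->
    fan E (st w k) (st w (S k)) /\ fan_nonlinearity E (st w k) (st w (S k));
  lw_ordered : forall k, (S k < len w)%nat ->
    tail_speed E w k <= head_speed E w (S k);
  lw_sonic : sonic_junctions E w
}.

Definition right_wave (E : eos) (w : wave) (W Wstar : state) : Prop :=
  left_wave E (mirror_wave w) (mirror W) (mirror Wstar).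

Definition compressive (E : eos) (w : wave) : Prop :=
  forall k, (k < len w)%nat ->
    ph E (st w k) <= ph E (st w (S k)) /\ vol (st w (S k)) <= vol (st w k).

Definition expansive (E : eos) (w : wave) : Prop :=
  forall k, (k < len w)%nat ->
    ph E (st w (S k)) <= ph E (st w k) /\ vol (st w k) <= vol (st w (S k)).

Definition riemann_solution (E : eos) (WL WR : state) (wL wR : wave) : Prop :=
  exists WsL WsR,
    left_wave E wL WL WsL /\ right_wave E wR WR WsR /\
    vel WsL = vel WsR /\ pres WsL = pres WsR.

Definition lambda_1_minus (E : eos) (wL : wave) : R := head_speed E wL 0.
Definition lambda_3_plus (E : eos) (wR : wave) : R :=
  - head_speed E (mirror_wave wR) 0.

(** Classical structure for the hydrodynamical equation of state alone: each
    acoustic wave is a single compressive shock or a single expansive fan, and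
    the star states are unique. *)
Definition hydro_state (E : eos) (W : state) : state :=
  State (rho W) (vel W) (ph E W).

Definition classical_left_wave (E : eos) (W0 W1 : state) : Prop :=
  admissible (hydro_part E) W1 /\
  (shock (hydro_part E) W0 W1 /\ pres W0 < pres W1 \/
   fan (hydro_part E) W0 W1 /\ pres W1 <= pres W0).

Definition hydro_riemann_solvable (E : eos) (WL WR : state) : Prop :=
  exists! Ws : state * state,
    classical_left_wave E (hydro_state E WL) (fst Ws) /\
    classical_left_wave E (mirror (hydro_state E WR)) (mirror (snd Ws)) /\
    vel (fst Ws) = vel (snd Ws) /\ pres (fst Ws) = pres (snd Ws).

Definition is_max_on (g : R -> R) (a b M : R) : Prop :=
  (exists t, a <= t <= b /\ g t = M) /\ (forall t, a <= t <= b -> g t <= M).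

(* Main.v *)
Require Import Defs.
From Stdlib Require Import Lra Lia.

(** On a Rayleigh line, a straight line through [(v0, P0)] in the [(v, P)]
    plane, the hydrodynamical Hugoniot function satisfies [dH = T ds]; convexity
    of the isentropes makes every critical point of [H] on the line a strict
    maximum.  Hence the slope [Q_h ^ 2] of hydrodynamical shocks increases with
    [P], dominates the sound speed for compressions and is dominated by it for
    expansions.

    For the full shock, [A_b] is the error of the trapezoidal rule for the
    monotone [p_b_hat], so it costs at most one half of the jump of [p_b_hat]
    times the jump of [v].  Together with the jump of [p_b_hat] itself this adds
    at most [2 * M] to [Q ^ 2].  If the outermost shock leaves the range of [v]
    over which [M] is the maximum, then the bound on its velocity or pressure jump
    alone already yields [Q <= Q_h]. *)

(** * Calculus *)

(** The star state is unknown, and the opposite wave decides what is known about it. If it is of the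
    same type as the wave at hand, it limits the velocity jump by that of the data; if of the other
    type, it limits the jump of total pressure. The outer maximum and minimum in the bounding
    pressures cover both possibilities. Subtracting [p_b_hat] at the initial volume turns a jump of
    total pressure into a difference from [ph], with no reference to the star volume.

    The obstacle is that a velocity bound controls only the product of the pressure and volume jumps
    of a shock. The volume may then overshoot the range of [M] while the pressure jump stays small,
    which forces the case split on the volume jump in both shock estimates. *)

Lemma C1_chain (f : R -> R -> R) (g h : R -> R) (t dg dh : R) :
  locally_2d (ex_diff_n f 1) (g t) (h t) ->
  is_derive g t dg -> is_derive h t dh ->
  is_derive (fun t => f (g t) (h t)) t
    (Derive (fun u => f u (h t)) (g t) * dg + Derive (fun v => f (g t) v) (h t) * dh).
Proof.
  intros Hf Hg Hh.
  pose proof (locally_2d_singleton _ _ _ Hf) as (_ & Hx & Hy & (Hcx & _) & _).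
  apply is_derive_Reals, derivable_pt_lim_comp_2d; try (apply is_derive_Reals; assumption).
  apply filterdiff_differentiable_pt_lim.
  (* Partial derivatives at the point alone do not give differentiability. The first one must exist
     nearby and be continuous, hence [Hf] is assumed on a neighbourhood. *)
  apply (is_derive_filterdiff f _ _ (fun u v => Derive (fun z => f z v) u)).
  - apply (locally_2d_locally
      (fun u v => is_derive (fun z => f z v) u (Derive (fun z => f z v) u))).
    destruct Hf as [d Hd]; exists d; intros u v Hu Hv.
    destruct (Hd u v Hu Hv) as (_ & Hex & _). now apply Derive_correct.
  - now apply Derive_correct.
  - exact (proj1 (continuity_2d_pt_filterlim _ _ _) Hcx).
Qed.

Lemma ex_derive_continuity_pt (f : R -> R) (x : R) : ex_derive f x -> continuity_pt f x.
Proof.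
  intros Hf. apply continuity_pt_filterlim.
  now apply (ex_derive_continuous (K := R_AbsRing) (V := R_NormedModule)).
Qed.

Lemma derive_pos_right (f : R -> R) (x l : R) :
  is_derive f x l -> 0 < l ->
  exists d, 0 < d /\ forall y, x < y < x + d -> f x < f y.
Proof.
  intros Hf Hl. apply is_derive_Reals in Hf.
  destruct (Hf (l / 2)) as [d Hd]; [lra|].
  exists d; split; [apply cond_pos|]. intros y Hy.
  specialize (Hd (y - x)). rewrite Rabs_pos_eq in Hd by lra.
  assert (H := Hd ltac:(lra) ltac:(lra)).
  apply Rabs_def2 in H. replace (x + (y - x)) with y in H by ring.
  assert (0 < (f y - f x) / (y - x)) by lra.
  assert (f y - f x = (f y - f x) / (y - x) * (y - x)) by (field; lra).
  assert (0 < (f y - f x) / (y - x) * (y - x)) by (apply Rmult_lt_0_compat; lra).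
  lra.
Qed.

Lemma derive_neg_right (f : R -> R) (x l : R) :
  is_derive f x l -> l < 0 ->
  exists d, 0 < d /\ forall y, x < y < x + d -> f y < f x.
Proof.
  intros Hf Hl.
  destruct (derive_pos_right (fun y => - f y) x (- l)) as (d & Hd & H).
  - now apply (is_derive_opp (V := R_NormedModule) f).
  - lra.
  - exists d; split; [assumption|]. intros y Hy. specialize (H y Hy). lra.
Qed.

Lemma derive_pos_left (f : R -> R) (x l : R) :
  is_derive f x l -> 0 < l ->
  exists d, 0 < d /\ forall y, x - d < y < x -> f y < f x.
Proof.
  intros Hf Hl.
  destruct (derive_neg_right (fun y => f (- y)) (- x) (- l)) as (d & Hd & H).
  - replace (- l) with (scal (opp (1 : R)) l)
      by (unfold scal, opp; simpl; unfold mult; simpl; ring).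
    apply (is_derive_comp f Ropp).
    + now rewrite Ropp_involutive.
    + apply (is_derive_opp (V := R_NormedModule) (fun y => y)).
      apply (is_derive_id (K := R_AbsRing)).
  - lra.
  - exists d; split; [assumption|]. intros y Hy.
    assert (H' := H (- y) ltac:(lra)). simpl in H'. now rewrite !Ropp_involutive in H'.
Qed.

(** An interior minimum would be a critical point, and there the hypothesis supplies a smaller value
    to the right. So the minimum sits at an end point only, and [h b] cannot equal it either. *)
Lemma above_endpoints (h : R -> R) (a c : R) :
  (forall t, a <= t <= c -> ex_derive h t) ->
  (forall t, a < t < c -> is_derive h t 0 ->
     forall eps, 0 < eps -> exists y, t < y < t + eps /\ h y < h t) ->
  forall b, a < b < c -> Rmin (h a) (h c) < h b.
Proof.
  intros Hd Hcrit b Hb.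
  assert (Hcont : forall t, a <= t <= c -> continuity_pt h t).
  { intros t Ht. apply ex_derive_continuity_pt; auto. }
  destruct (continuity_ab_min h a c) as (t & Hmin & Ht); [lra|exact Hcont|].
  assert (Hint : forall s, a < s < c -> ~ (forall r, a <= r <= c -> h s <= h r)).
  { intros s Hs Hms.
    destruct (Hd s ltac:(lra)) as [l Hl].
    assert (l = 0) as ->.
    { destruct (Rtotal_order l 0) as [Hl0|[Hl0|Hl0]]; [exfalso|exact Hl0|exfalso].
      - destruct (derive_neg_right h s l Hl Hl0) as (d & Hdp & H).
        set (e := Rmin d (c - s)).
        assert (0 < e) by (apply Rmin_glb_lt; lra).
        assert (e <= d) by apply Rmin_l. assert (e <= c - s) by apply Rmin_r.
        specialize (H (s + e / 2) ltac:(lra)). specialize (Hms (s + e / 2) ltac:(lra)). lra.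
      - destruct (derive_pos_left h s l Hl Hl0) as (d & Hdp & H).
        set (e := Rmin d (s - a)).
        assert (0 < e) by (apply Rmin_glb_lt; lra).
        assert (e <= d) by apply Rmin_l. assert (e <= s - a) by apply Rmin_r.
        specialize (H (s - e / 2) ltac:(lra)). specialize (Hms (s - e / 2) ltac:(lra)). lra. }
    destruct (Hcrit s Hs Hl (c - s) ltac:(lra)) as (y & Hy & Hlt).
    specialize (Hms y ltac:(lra)). lra. }
  assert (Rmin (h a) (h c) <= h t).
  { destruct (Req_dec t a) as [->|]; [apply Rmin_l|].
    destruct (Req_dec t c) as [->|]; [apply Rmin_r|].
    exfalso. apply (Hint t); [lra|exact Hmin]. }
  assert (h t <= h b) by (apply Hmin; lra).
  destruct (Rle_lt_or_eq_dec (h t) (h b)) as [|Heq]; [assumption|lra|].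
  exfalso. apply (Hint b Hb). intros r Hr. rewrite <- Heq. auto.
Qed.

Lemma locally_2d_gt (f : R -> R -> R) (x y c : R) :
  continuity_2d_pt f x y -> c < f x y -> locally_2d (fun u v => c < f u v) x y.
Proof.
  intros Hf Hc.
  destruct (Hf (mkposreal _ (proj2 (Rlt_0_minus _ _) Hc))) as [d Hd].
  exists d; intros u v Hu Hv. specialize (Hd u v Hu Hv). simpl in Hd.
  apply Rabs_def2 in Hd. lra.
Qed.

Lemma continuity_2d_pt_comp (f g h : R -> R -> R) (x y : R) :
  continuity_2d_pt f (g x y) (h x y) ->
  continuity_2d_pt g x y -> continuity_2d_pt h x y ->
  continuity_2d_pt (fun u v => f (g u v) (h u v)) x y.
Proof.
  intros Hf Hg Hh eps.
  destruct (Hf eps) as [d Hd].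
  destruct (Hg d) as [dg Hdg], (Hh d) as [dh Hdh].
  assert (Hm : 0 < Rmin dg dh) by (apply Rmin_glb_lt; apply cond_pos).
  exists (mkposreal _ Hm); simpl; intros u v Hu Hv.
  assert (Rmin dg dh <= dg) by apply Rmin_l. assert (Rmin dg dh <= dh) by apply Rmin_r.
  apply Hd; [apply Hdg|apply Hdh]; lra.
Qed.

(** * The hydrodynamical equation of state *)

Section Equation_of_state.

Variable E : eos.
Hypothesis HE : complete_eos E.
Hypothesis Hconvex : hydro_convexity E.
Hypothesis Henergy : hydro_energy E.

Lemma range_open (v P : R) :
  0 < v -> - p_inf E < P -> locally_2d (fun w Q => 0 < w /\ - p_inf E < Q) v P.
Proof.
  intros Hv HP. apply locally_2d_and; apply locally_2d_gt; try assumption.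
  - apply continuity_2d_pt_id1.
  - apply continuity_2d_pt_id2.
Qed.

Lemma p_hat_s_hat (v P : R) : 0 < v -> - p_inf E < P -> p_hat E v (s_hat E v P) = P.
Proof.
  intros Hv HP. pose proof (e_hat_section E HE v P Hv HP) as Hs.
  rewrite <- Hs at 2.
  rewrite <- (p_hat_isentrope E HE (/ v) (e_hat E v P)).
  - now rewrite Rinv_inv.
  - now apply Rinv_0_lt_compat.
  - now rewrite Hs.
Qed.

Lemma s_h_C1_near (v P : R) :
  0 < v -> - p_inf E < P -> locally_2d (ex_diff_n (s_h E) 1) (/ v) (e_hat E v P).
Proof.
  intros Hv HP. assert (Hr := Rinv_0_lt_compat _ Hv).
  pose proof (e_hat_section E HE v P Hv HP) as Hs.
  apply (locally_2d_impl (fun r e => 0 < r /\ - p_inf E < p_h E r e)).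
  - apply locally_2d_forall. intros r e [H1 H2].
    apply (ex_diff_n_m 2); [lia|]. now apply (s_h_C2 E HE).
  - apply locally_2d_and; apply locally_2d_gt; try assumption.
    + apply continuity_2d_pt_id1.
    + apply (p_h_C2 E HE); [assumption|lra].
    + lra.
Qed.

Lemma temperature_pos (v P : R) :
  0 < v -> - p_inf E < P -> 0 < Derive (fun e => s_h E (/ v) e) (e_hat E v P).
Proof.
  intros Hv HP. apply (gibbs_temperature E HE).
  - now apply Rinv_0_lt_compat.
  - now rewrite (e_hat_section E HE).
Qed.

(* [T ds = de + P dv] along a curve in the [(v, P)] plane *)
Lemma gibbs_along (r : R -> R) (v dr : R) :
  0 < v -> - p_inf E < r v -> is_derive r v dr ->
  exists de, is_derive (fun w => e_hat E w (r w)) v de /\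
    is_derive (fun w => s_hat E w (r w)) v
      (Derive (fun e => s_h E (/ v) e) (e_hat E v (r v)) * (de + r v)).
Proof.
  intros Hv HP Hr. assert (Hi := Rinv_0_lt_compat _ Hv).
  assert (Hid : is_derive (fun w : R => w) v 1) by apply (is_derive_id (K := R_AbsRing)).
  eassert (He : is_derive (fun w => e_hat E w (r w)) v _).
  { apply (C1_chain (e_hat E) (fun w => w) r); [|exact Hid|exact Hr].
    apply (locally_2d_impl (fun w Q => 0 < w /\ - p_inf E < Q)); [|now apply range_open].
    apply locally_2d_forall. intros w Q [H1 H2].
    apply (ex_diff_n_m 2); [lia|]. now apply (e_hat_C2 E HE). }
  eexists; split; [exact He|].
  eassert (Hinv : is_derive Rinv v _).
  { apply (is_derive_inv (fun w : R => w)); [exact Hid|lra]. }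
  pose proof (C1_chain (s_h E) Rinv (fun w => e_hat E w (r w)) v _ _
    (s_h_C1_near v (r v) Hv HP) Hinv He) as Hs.
  match type of Hs with is_derive _ _ ?l =>
    match goal with |- is_derive _ _ ?l' => replace l' with l; [exact Hs|] end end.
  assert (Hsec := e_hat_section E HE v (r v) Hv HP).
  cbv beta.
  rewrite (gibbs_pressure E HE) by (rewrite ?Hsec; assumption).
  rewrite Hsec. field. lra.
Qed.

Lemma s_hat_continuous (v P : R) :
  0 < v -> - p_inf E < P -> continuity_2d_pt (s_hat E) v P.
Proof.
  intros Hv HP. unfold s_hat.
  apply (continuity_2d_pt_comp (s_h E) (fun u _ => / u) (e_hat E)).
  - pose proof (locally_2d_singleton _ _ _ (s_h_C1_near v P Hv HP)) as [H _]. exact H.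
  - apply (continuity_2d_pt_inv (fun u _ => u)); [apply continuity_2d_pt_id1|lra].
  - apply (e_hat_C2 E HE v P Hv HP).
Qed.

(** The energy is only nondecreasing in the pressure, so the mean value theorem gives a weak
    inequality. Strictness comes from injectivity: [p_hat] recovers the pressure from the
    entropy. *)
Lemma s_hat_increasing (v P Q : R) :
  0 < v -> - p_inf E < P -> P < Q -> s_hat E v P < s_hat E v Q.
Proof.
  intros Hv HP HPQ.
  set (T := fun x => Derive (fun e => s_h E (/ v) e) (e_hat E v x)).
  set (de := fun x => Derive (fun y => e_hat E v y) x).
  destruct (MVT_cor2 (fun x => s_hat E v x) (fun x => de x * T x) P Q HPQ) as (c & Hc & Hcb).
  { intros c Hc. apply is_derive_Reals.
    destruct (e_hat_C2 E HE v c Hv ltac:(lra)) as (_ & _ & Hex & _).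
    pose proof (locally_2d_singleton _ _ _ (s_h_C1_near v c Hv ltac:(lra))) as (_ & _ & Hes & _).
    apply (is_derive_comp (fun e => s_h E (/ v) e) (fun y => e_hat E v y)).
    - now apply Derive_correct.
    - now apply Derive_correct. }
  destruct (Henergy v c Hv ltac:(lra)) as (_ & He & _). fold (de c) in He.
  assert (0 < T c) by (apply temperature_pos; lra).
  assert (s_hat E v P <= s_hat E v Q).
  { assert (0 <= de c * T c * (Q - P)) by (apply Rmult_le_pos; [apply Rmult_le_pos|]; lra). lra. }
  destruct (Req_dec (s_hat E v P) (s_hat E v Q)) as [Heq|]; [|lra].
  exfalso. pose proof (p_hat_s_hat v P Hv HP) as HP1. rewrite Heq in HP1.
  rewrite p_hat_s_hat in HP1; lra.
Qed.

(** Smoothness of [p_hat] is given only at entropies of the form [s_hat E v P], while the chain rule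
    needs a full neighbourhood. Nearby pairs are reached by the intermediate value theorem in the
    pressure. *)
Lemma s_hat_open (v P : R) :
  0 < v -> - p_inf E < P ->
  locally_2d (fun w s => 0 < w /\ exists Q, - p_inf E < Q /\ s_hat E w Q = s) v (s_hat E v P).
Proof.
  intros Hv HP.
  (* Half the distance to [- p_inf E], so that [P - d] stays admissible. *)
  set (d := (P + p_inf E) / 2).
  assert (Hd : 0 < d) by (unfold d; lra).
  assert (Hlo : - p_inf E < P - d) by (unfold d; lra).
  set (f := fun (Q w s : R) => s_hat E w Q - s).
  assert (Hcont : forall Q s, - p_inf E < Q -> continuity_2d_pt (f Q) v s).
  { intros Q s HQ. apply continuity_2d_pt_minus; [|apply continuity_2d_pt_id2].
    apply (continuity_2d_pt_comp (s_hat E) (fun u _ => u) (fun _ _ => Q)).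
    - now apply s_hat_continuous.
    - apply continuity_2d_pt_id1.
    - apply continuity_2d_pt_const. }
  apply (locally_2d_impl (fun w s => 0 < w /\ 0 < f (P + d) w s /\ 0 < - f (P - d) w s)).
  - apply locally_2d_forall. intros w s (Hw & Hhi & Hlow). split; [assumption|].
    destruct (Ranalysis5.IVT_interv (fun Q => s_hat E w Q - s) (P - d) (P + d))
      as (Q & HQ & HQ0); unfold f in *; try lra.
    + intros a Ha. apply continuity_pt_minus; [|apply continuity_pt_const; now intros ? ?].
      intros eps Heps.
      destruct (s_hat_continuous w a Hw ltac:(lra) (mkposreal eps Heps)) as [k Hk].
      exists k; split; [apply cond_pos|]. intros x [_ Hx]. simpl in Hk |- *.
      apply Hk; [|exact Hx]. rewrite Rminus_diag, Rabs_R0. apply cond_pos.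
    + exists Q. split; lra.
  - assert (s_hat E v P < s_hat E v (P + d)) by (apply s_hat_increasing; lra).
    assert (s_hat E v (P - d) < s_hat E v P) by (apply s_hat_increasing; lra).
    repeat apply locally_2d_and.
    + apply locally_2d_gt; [apply continuity_2d_pt_id1|assumption].
    + apply locally_2d_gt; [apply Hcont; lra|unfold f; lra].
    + apply locally_2d_gt; [apply continuity_2d_pt_opp, Hcont; lra|unfold f; lra].
Qed.

Lemma p_hat_C2_near (v P : R) :
  0 < v -> - p_inf E < P -> locally_2d (ex_diff_n (p_hat E) 2) v (s_hat E v P).
Proof.
  intros Hv HP. apply (locally_2d_impl _ _ _ _) with (2 := s_hat_open v P Hv HP).
  apply locally_2d_forall. intros w s (Hw & Q & HQ & <-). now apply (p_hat_C2 E HE).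
Qed.

(** * The Hugoniot function along Rayleigh lines *)

Definition hug (v0 P0 v P : R) : R :=
  e_hat E v P - e_hat E v0 P0 + / 2 * (P + P0) * (v - v0).

(** Oriented so that [m], minus the slope of the line, is [Q_h ^ 2] for a hydrodynamical shock along
    it. *)
Definition ray (v0 P0 m v : R) : R := P0 + m * (v0 - v).

(* Since [d hug = T ds] along a Rayleigh line, differentiating
   [p_hat v (s v) = ray v] relates the slope of [hug] to that of the isentrope. *)
Lemma rayleigh_slope (v0 P0 m v : R) :
  0 < v -> - p_inf E < ray v0 P0 m v ->
  let S := fun w => s_hat E w (ray v0 P0 m w) in
  exists T d, 0 < T /\
    is_derive (fun w => hug v0 P0 w (ray v0 P0 m w)) v d /\
    is_derive S v (T * d) /\
    Derive (fun w => p_hat E w (S v)) v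
      + Derive (fun s => p_hat E v s) (S v) * (T * d) = - m.
Proof.
  intros Hv HP S.
  assert (Hid : is_derive (fun w : R => w) v 1) by apply (is_derive_id (K := R_AbsRing)).
  assert (Hr : forall w, is_derive (ray v0 P0 m) w (- m)).
  { intros w. unfold ray. auto_derive; [exact I|ring]. }
  destruct (gibbs_along (ray v0 P0 m) v (- m) Hv HP (Hr v)) as (de & He & Hs).
  (* The witness for [T] is the reciprocal of the temperature. *)
  exists (Derive (fun e => s_h E (/ v) e) (e_hat E v (ray v0 P0 m v))), (de + ray v0 P0 m v).
  split; [now apply temperature_pos|].
  split; [|split; [exact Hs|]].
  - unfold hug.
    apply is_derive_Reals in He. apply is_derive_Reals.
    (* On the line, [m * (v0 - v)] equals the pressure difference to [P0], so the derivative of the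
       trapezoidal term is exactly the local pressure. This is why [hug] and the entropy have the
       same critical points there. *)
    assert (Hrest : is_derive (fun w => - e_hat E v0 P0 + / 2 * (ray v0 P0 m w + P0) * (w - v0))
      v (ray v0 P0 m v)).
    { unfold ray. auto_derive; [exact I|field]. }
    apply is_derive_Reals in Hrest.
    pose proof (derivable_pt_lim_plus _ _ _ _ _ He Hrest) as H.
    apply is_derive_Reals. apply is_derive_Reals in H.
    eapply is_derive_ext; [|exact H]. intros t; unfold plus_fct; simpl; ring.
  - assert (Hp : is_derive (fun w => p_hat E w (S w)) v
      (Derive (fun w => p_hat E w (S v)) v * 1 + Derive (fun s => p_hat E v s) (S v) *
        (Derive (fun e => s_h E (/ v) e) (e_hat E v (ray v0 P0 m v)) * (de + ray v0 P0 m v)))).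
    { apply (C1_chain (p_hat E) (fun w => w) S); [|exact Hid|exact Hs].
      apply (locally_2d_impl _ _ _ _) with (2 := p_hat_C2_near v _ Hv HP).
      apply locally_2d_forall. intros w s. apply ex_diff_n_m; lia. }
    assert (Hp' : is_derive (fun w => p_hat E w (S w)) v (- m)).
    { apply (is_derive_ext_loc (ray v0 P0 m)); [|apply Hr].
      assert (Hpos : locally_2d (fun w _ : R => 0 < w /\ 0 < ray v0 P0 m w + p_inf E) v 0).
      { apply locally_2d_and; apply locally_2d_gt; try lra.
        - apply continuity_2d_pt_id1.
        - unfold ray.
          repeat first [apply continuity_2d_pt_id1 | apply continuity_2d_pt_const
            | apply continuity_2d_pt_minus | apply continuity_2d_pt_plus
            | apply continuity_2d_pt_mult]. }
      apply locally_2d_1d_const_y in Hpos.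
      revert Hpos. apply filter_imp. intros w [Hw1 Hw2].
      symmetry. apply p_hat_s_hat; lra. }
    apply is_derive_unique in Hp, Hp'. rewrite Hp in Hp'. rewrite <- Hp'. ring.
Qed.
(* Where [s] is stationary along a Rayleigh line, convexity of the isentropes
   makes the slope of [hug] decrease through zero. *)
Lemma rayleigh_critical (v0 P0 m v : R) :
  0 < v -> - p_inf E < ray v0 P0 m v ->
  is_derive (fun w => hug v0 P0 w (ray v0 P0 m w)) v 0 ->
  forall eps, 0 < eps -> exists y, v < y < v + eps /\
    hug v0 P0 y (ray v0 P0 m y) < hug v0 P0 v (ray v0 P0 m v).
Proof.
  intros Hv HP Hd0 eps Heps.
  destruct (rayleigh_slope v0 P0 m v Hv HP) as (T & d & HT & Hd & HS & Hrel).
  set (S := fun w => s_hat E w (ray v0 P0 m w)) in *.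
  assert (d = 0) as ->.
  { apply is_derive_unique in Hd, Hd0. now rewrite Hd in Hd0. }
  set (pv := fun u s => Derive (fun z => p_hat E z s) u).
  (* Stationarity of [S] leaves only the second volume derivative of [p_hat], which is positive.
     Right of [v] the isentropic slope [pv] therefore exceeds its value [- m] at [v], and
     [rayleigh_slope] at such a point makes the derivative of [hug] negative. *)
  assert (Hphi : is_derive (fun w => pv w (S w)) v
    (Derive (fun u => pv u (S v)) v * 1 + Derive (fun s => pv v s) (S v) * (T * 0))).
  { apply (C1_chain pv (fun w => w) S); [|apply (is_derive_id (K := R_AbsRing))|exact HS].
    apply (locally_2d_impl _ _ _ _) with (2 := p_hat_C2_near v _ Hv HP).
    apply locally_2d_forall. intros w s. apply ex_diff_n_deriv_aux1. }
  assert (Hpvv : 0 < Derive (fun u => pv u (S v)) v) by apply (Hconvex v _ Hv HP).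
  destruct (derive_pos_right _ _ _ Hphi) as (e1 & He1 & Hright); [lra|].
  assert (Hray : exists e2, 0 < e2 /\ forall w, v < w < v + e2 -> - p_inf E < ray v0 P0 m w).
  (* The line loses at most [Rabs m] of pressure per unit of volume; adding 1 covers [m = 0]. *)
  { exists ((ray v0 P0 m v + p_inf E) / (Rabs m + 1)).
    assert (0 < Rabs m + 1) by (pose proof (Rabs_pos m); lra).
    split; [apply Rdiv_lt_0_compat; lra|].
    intros w Hw.
    assert (Hlt : (w - v) * (Rabs m + 1) < ray v0 P0 m v + p_inf E).
    { apply Rmult_lt_reg_r with (/ (Rabs m + 1)); [now apply Rinv_0_lt_compat|].
      rewrite Rmult_assoc, Rinv_r by lra.
      fold ((ray v0 P0 m v + p_inf E) / (Rabs m + 1)). lra. }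
    assert (ray v0 P0 m w = ray v0 P0 m v - m * (w - v)) by (unfold ray; ring).
    pose proof (Rle_abs m).
    assert (m * (w - v) <= Rabs m * (w - v)) by (apply Rmult_le_compat_r; lra).
    lra. }
  destruct Hray as (e2 & He2 & Hray).
  set (e := Rmin eps (Rmin e1 e2)).
  assert (0 < e) by (repeat apply Rmin_glb_lt; lra).
  assert (Ha : e <= eps) by apply Rmin_l.
  assert (Hb : e <= Rmin e1 e2) by apply Rmin_r.
  pose proof (Rmin_l e1 e2). pose proof (Rmin_r e1 e2).
  exists (v + e / 2). split; [lra|].
  assert (Hin : forall w, v <= w <= v + e / 2 -> 0 < w /\ - p_inf E < ray v0 P0 m w).
  { intros w Hw. split; [lra|]. destruct (Req_dec w v) as [->|]; [assumption|].
    apply Hray; lra. }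
  destruct (MVT_cor2 (fun w => hug v0 P0 w (ray v0 P0 m w))
    (fun c => Derive (fun w => hug v0 P0 w (ray v0 P0 m w)) c) v (v + e / 2))
    as (c & Hc & Hcb); [lra| |].
  { intros c Hc. destruct (Hin c Hc) as [Hc1 Hc2].
    destruct (rayleigh_slope v0 P0 m c Hc1 Hc2) as (T' & d' & _ & Hd' & _).
    apply is_derive_Reals, Derive_correct. now exists d'. }
  destruct (Hin c ltac:(lra)) as [Hc1 Hc2].
  destruct (rayleigh_slope v0 P0 m c Hc1 Hc2) as (T' & d' & HT' & Hd' & _ & Hrel').
  assert (Hu : Derive (fun w => hug v0 P0 w (ray v0 P0 m w)) c = d')
    by now apply is_derive_unique.
  rewrite Hu in Hc.
  specialize (Hright c ltac:(lra)). unfold pv, S in Hright, Hrel.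
  destruct (Henergy c _ Hc1 Hc2) as (_ & _ & Hps & _).
  assert (Hd'neg : d' < 0).
  { set (k := Derive (fun s => p_hat E c s) (s_hat E c (ray v0 P0 m c))) in *.
    assert (0 < k * T') by now apply Rmult_lt_0_compat.
    destruct (Rlt_le_dec d' 0); [assumption|exfalso].
    assert (0 <= k * T' * d') by (apply Rmult_le_pos; lra).
    lra. }
  assert (0 < - d' * (v + e / 2 - v)) by (apply Rmult_lt_0_compat; lra).
  lra.
Qed.

(** Strict quasi-concavity of [hug] on a Rayleigh line. Admissibility at the two ends suffices
    because the pressure is affine in between. *)
Lemma rayleigh_above (v0 P0 m a b c : R) :
  0 < a -> a < b < c ->
  - p_inf E < ray v0 P0 m a -> - p_inf E < ray v0 P0 m c ->
  Rmin (hug v0 P0 a (ray v0 P0 m a)) (hug v0 P0 c (ray v0 P0 m c))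
    < hug v0 P0 b (ray v0 P0 m b).
Proof.
  intros Ha Hb Hra Hrc.
  assert (Hin : forall t, a <= t <= c -> - p_inf E < ray v0 P0 m t).
  { intros t Ht. unfold ray in *. destruct (Rle_lt_dec 0 m); nra. }
  apply (above_endpoints (fun w => hug v0 P0 w (ray v0 P0 m w)) a c); [| |assumption].
  - intros t Ht.
    destruct (rayleigh_slope v0 P0 m t) as (T & d & _ & Hd & _); [lra|now apply Hin|].
    now exists d.
  - intros t Ht Hd. apply rayleigh_critical; [lra|apply Hin; lra|assumption].
Qed.

(** * Monotonicity and zeros of the Hugoniot function *)

Lemma e_hat_monotone (v P Q : R) :
  0 < v -> - p_inf E < P -> P <= Q -> e_hat E v P <= e_hat E v Q.
Proof.
  intros Hv HP [HPQ| ->]; [|apply Rle_refl].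
  destruct (MVT_cor2 (fun x => e_hat E v x) (fun c => Derive (fun x => e_hat E v x) c) P Q HPQ)
    as (c & Hc & Hcb).
  { intros c Hc. destruct (e_hat_C2 E HE v c Hv ltac:(lra)) as (_ & _ & Hex & _).
    now apply is_derive_Reals, Derive_correct. }
  destruct (Henergy v c Hv ltac:(lra)) as (_ & He & _).
  assert (0 <= Derive (fun x => e_hat E v x) c * (Q - P)) by (apply Rmult_le_pos; lra).
  lra.
Qed.

Lemma e_hat_growth (v w P : R) :
  0 < v -> - p_inf E < P -> v <= w -> p_inf E * (w - v) <= e_hat E w P - e_hat E v P.
Proof.
  intros Hv HP [Hvw| ->]; [|lra].
  destruct (MVT_cor2 (fun x => e_hat E x P) (fun c => Derive (fun x => e_hat E x P) c) v w Hvw)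
    as (c & Hc & Hcb).
  { intros c Hc. destruct (e_hat_C2 E HE c P ltac:(lra) HP) as (_ & Hex & _).
    now apply is_derive_Reals, Derive_correct. }
  destruct (Henergy c P ltac:(lra) HP) as (He & _).
  rewrite Hc. apply Rmult_le_compat_r; lra.
Qed.

(** For [P0] above [- p_inf E] the coefficient is positive. The quantitative form gives zeros far
    out and later converts the error [A_b] into a displacement of the volume. *)
Lemma hug_growth (v0 P0 v w P : R) :
  0 < v -> - p_inf E < P -> v <= w ->
  (p_inf E + / 2 * (P + P0)) * (w - v) <= hug v0 P0 w P - hug v0 P0 v P.
Proof.
  intros Hv HP Hvw. pose proof (e_hat_growth v w P Hv HP Hvw). unfold hug. lra.
Qed.

Lemma hug_self (v0 P0 : R) : hug v0 P0 v0 P0 = 0.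
Proof. unfold hug. ring. Qed.

Lemma hug_increasing (v0 P0 v w P : R) :
  0 < v -> - p_inf E < P -> - p_inf E < P0 -> v < w -> hug v0 P0 v P < hug v0 P0 w P.
Proof.
  intros Hv HP HP0 Hvw. pose proof (hug_growth v0 P0 v w P Hv HP ltac:(lra)).
  assert (0 < (p_inf E + / 2 * (P + P0)) * (w - v)) by (apply Rmult_lt_0_compat; lra).
  lra.
Qed.

Lemma hug_root (v0 P0 P : R) :
  0 < v0 -> - p_inf E < P0 -> - p_inf E < P -> exists w, 0 < w /\ hug v0 P0 w P = 0.
Proof.
  intros Hv0 HP0 HP.
  set (K := p_inf E + / 2 * (P + P0)).
  assert (HK : 0 < K) by (unfold K; lra).
  destruct (Henergy v0 P Hv0 HP) as (_ & _ & _ & _ & Hlim).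
  (* Near zero volume [e_hat] at [P] is within this tolerance of [q_ref], while the remaining terms
     of [hug] contribute at most [- K * (v0 - lo)] relative to [q_ref]. With [lo] at most [v0 / 2]
     the sum is negative. *)
  assert (Heps : 0 < K * (v0 / 2)) by (apply Rmult_lt_0_compat; lra).
  destruct (proj1 (filterlim_locally _ _) Hlim (mkposreal _ Heps)) as [d Hd].
  simpl in Hd.
  assert (Hdpos := cond_pos d).
  set (lo := Rmin (d / 2) (v0 / 2)).
  assert (Hlo : 0 < lo) by (apply Rmin_glb_lt; lra).
  assert (lo <= d / 2) by apply Rmin_l. assert (lo <= v0 / 2) by apply Rmin_r.
  assert (Hneg : hug v0 P0 lo P < 0).
  { assert (Hb : ball (q_ref E) (K * (v0 / 2)) (e_hat E lo P)).
    { apply Hd; [|lra]. change (Rabs (lo - 0) < d). rewrite Rabs_pos_eq; lra. }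
    change (Rabs (e_hat E lo P - q_ref E) < K * (v0 / 2)) in Hb. apply Rabs_def2 in Hb.
    pose proof (e_hat_growth lo v0 P0 Hlo HP0 ltac:(lra)).
    destruct (Henergy lo P0 Hlo HP0) as (_ & _ & _ & Hq & _).
    assert (K * (v0 / 2) <= K * (v0 - lo)) by (apply Rmult_le_compat_l; lra).
    unfold hug. unfold K in *. lra. }
  set (hi := v0 + Rabs (hug v0 P0 v0 P) / K + 1).
  assert (0 <= Rabs (hug v0 P0 v0 P) / K)
    by (apply Rmult_le_pos; [apply Rabs_pos|left; now apply Rinv_0_lt_compat]).
  assert (Hpos : 0 < hug v0 P0 hi P).
  { pose proof (hug_growth v0 P0 v0 hi P Hv0 HP ltac:(unfold hi; lra)) as Hg.
    fold K in Hg.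
    replace (K * (hi - v0)) with (Rabs (hug v0 P0 v0 P) + K) in Hg
      by (unfold hi; field; lra).
    pose proof (Rle_abs (- hug v0 P0 v0 P)) as Ha. rewrite Rabs_Ropp in Ha. lra. }
  destruct (Ranalysis5.IVT_interv (fun w => hug v0 P0 w P) lo hi) as (w & Hw & Hw0);
    [|unfold hi; lra|assumption|assumption|].
  - intros a Ha. unfold hug.
    destruct (e_hat_C2 E HE a P ltac:(lra) HP) as (_ & Hex & _).
    apply ex_derive_continuity_pt. auto_derive. exact Hex.
  - exists w. split; [lra|assumption].
Qed.

(* If the slope decreased, the point of pressure [P'] on the Rayleigh line
   through [(y, P)] would have [hug > 0], contradicting [rayleigh_above]. *)
Lemma shock_slope_monotone (v0 P0 y P y' P' : R) :
  - p_inf E < P0 -> P0 < P < P' -> y < v0 -> 0 < y' < v0 ->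
  hug v0 P0 y P = 0 -> hug v0 P0 y' P' = 0 ->
  (P - P0) * (v0 - y') <= (P' - P0) * (v0 - y).
Proof.
  intros HP0 HP Hy Hy' H H'.
  destruct (Rle_lt_dec ((P - P0) * (v0 - y')) ((P' - P0) * (v0 - y))) as [|Hlt]; [assumption|].
  exfalso.
  set (m := (P - P0) / (v0 - y)).
  assert (Hm : 0 < m) by (apply Rdiv_lt_0_compat; lra).
  set (x := v0 - (P' - P0) / m).
  assert (Hx1 : y' < x).
  { unfold x. enough ((P' - P0) / m < v0 - y') by lra.
    apply Rmult_lt_reg_r with m; [assumption|].
    replace ((P' - P0) / m * m) with (P' - P0) by (field; lra).
    apply Rmult_lt_reg_r with (v0 - y); [lra|].
    unfold m. replace ((v0 - y') * ((P - P0) / (v0 - y)) * (v0 - y))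
      with ((P - P0) * (v0 - y')) by (field; lra). assumption. }
  assert (Hx2 : x < y).
  { unfold x. enough (v0 - y < (P' - P0) / m) by lra.
    apply Rmult_lt_reg_r with m; [assumption|].
    replace ((P' - P0) / m * m) with (P' - P0) by (field; lra).
    unfold m. replace ((v0 - y) * ((P - P0) / (v0 - y))) with (P - P0) by (field; lra). lra. }
  assert (Rx : ray v0 P0 m x = P') by (unfold ray, x; field; lra).
  assert (Ry : ray v0 P0 m y = P) by (unfold ray, m; field; lra).
  assert (R0 : ray v0 P0 m v0 = P0) by (unfold ray; ring).
  pose proof (rayleigh_above v0 P0 m x y v0) as Habove.
  rewrite Rx, Ry, R0, H, hug_self in Habove.
  specialize (Habove ltac:(lra) ltac:(lra) ltac:(lra) HP0).
  pose proof (hug_increasing v0 P0 y' x P' ltac:(lra) ltac:(lra) HP0 Hx1) as Hinc.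
  rewrite Rmin_right in Habove; lra.
Qed.

(** [hug] vanishes at both [y] and [v0] on their Rayleigh line, hence is positive between them and
    cannot increase at [v0]. By [rayleigh_slope] the line is then at least as steep as the
    isentrope: compressions are supersonic relative to the state ahead. *)
Lemma shock_slope_ge_sound (v0 P0 y P : R) :
  - p_inf E < P0 -> P0 < P -> 0 < y < v0 -> hug v0 P0 y P = 0 ->
  a_h2 E v0 (s_hat E v0 P0) * (v0 - y) <= v0 ^ 2 * (P - P0).
Proof.
  intros HP0 HP Hy H.
  set (m := (P - P0) / (v0 - y)).
  assert (Ry : ray v0 P0 m y = P) by (unfold ray, m; field; lra).
  assert (R0 : ray v0 P0 m v0 = P0) by (unfold ray; ring).
  destruct (rayleigh_slope v0 P0 m v0) as (T & d & HT & Hd & _ & Hrel); [lra|lra|].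
  rewrite R0 in Hrel.
  assert (Hd0 : d <= 0).
  { destruct (Rle_lt_dec d 0) as [|Hpos]; [assumption|exfalso].
    destruct (derive_pos_left _ _ _ Hd Hpos) as (e & He & Hleft).
    set (t := v0 - Rmin e (v0 - y) / 2).
    assert (0 < Rmin e (v0 - y)) by (apply Rmin_glb_lt; lra).
    pose proof (Rmin_l e (v0 - y)). pose proof (Rmin_r e (v0 - y)).
    specialize (Hleft t ltac:(unfold t; lra)). simpl in Hleft.
    pose proof (rayleigh_above v0 P0 m y t v0 ltac:(lra) ltac:(unfold t; lra)
      ltac:(lra) ltac:(lra)) as Habove.
    rewrite R0, hug_self in Hleft. rewrite Ry, R0, H, hug_self, Rmin_left in Habove; lra. }
  destruct (Henergy v0 P0 ltac:(lra) HP0) as (_ & _ & Hps & _).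
  set (k := Derive (fun s => p_hat E v0 s) (s_hat E v0 P0)) in *.
  assert (0 <= k * T * (- d)) by (apply Rmult_le_pos; [apply Rmult_le_pos|]; lra).
  replace (P - P0) with (m * (v0 - y)) by (unfold m; field; lra).
  unfold a_h2. set (pv := Derive (fun w => p_hat E w (s_hat E v0 P0)) v0) in *.
  replace (- v0 ^ 2 * pv * (v0 - y)) with (v0 ^ 2 * (- pv * (v0 - y))) by ring.
  apply Rmult_le_compat_l; [apply pow2_ge_0|]. apply Rmult_le_compat_r; lra.
Qed.

(** The segment now lies to the right of [v0], so positivity inside makes [hug] nondecreasing at
    [v0] and reverses the comparison with the isentrope. *)
Lemma expansion_slope_le_sound (v0 P0 y P : R) :
  0 < v0 -> - p_inf E < P < P0 -> v0 < y -> hug v0 P0 y P = 0 ->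
  v0 ^ 2 * (P0 - P) <= a_h2 E v0 (s_hat E v0 P0) * (y - v0).
Proof.
  intros Hv0 HP Hy H.
  set (m := (P0 - P) / (y - v0)).
  assert (Ry : ray v0 P0 m y = P) by (unfold ray, m; field; lra).
  assert (R0 : ray v0 P0 m v0 = P0) by (unfold ray; ring).
  destruct (rayleigh_slope v0 P0 m v0) as (T & d & HT & Hd & _ & Hrel); [lra|lra|].
  rewrite R0 in Hrel.
  assert (Hd0 : 0 <= d).
  { destruct (Rle_lt_dec 0 d) as [|Hneg]; [assumption|exfalso].
    destruct (derive_neg_right _ _ _ Hd Hneg) as (e & He & Hright).
    set (t := v0 + Rmin e (y - v0) / 2).
    assert (0 < Rmin e (y - v0)) by (apply Rmin_glb_lt; lra).
    pose proof (Rmin_l e (y - v0)). pose proof (Rmin_r e (y - v0)).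
    specialize (Hright t ltac:(unfold t; lra)). simpl in Hright.
    pose proof (rayleigh_above v0 P0 m v0 t y ltac:(lra) ltac:(unfold t; lra)
      ltac:(lra) ltac:(lra)) as Habove.
    rewrite R0, hug_self in Hright. rewrite Ry, R0, H, hug_self, Rmin_left in Habove; lra. }
  destruct (Henergy v0 P0 ltac:(lra) ltac:(lra)) as (_ & _ & Hps & _).
  set (k := Derive (fun s => p_hat E v0 s) (s_hat E v0 P0)) in *.
  assert (0 <= k * T * d) by (apply Rmult_le_pos; [apply Rmult_le_pos|]; lra).
  replace (P0 - P) with (m * (y - v0)) by (unfold m; field; lra).
  unfold a_h2. set (pv := Derive (fun w => p_hat E w (s_hat E v0 P0)) v0) in *.
  replace (- v0 ^ 2 * pv * (y - v0)) with (v0 ^ 2 * (- pv * (y - v0))) by ring.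
  apply Rmult_le_compat_l; [apply pow2_ge_0|]. apply Rmult_le_compat_r; lra.
Qed.

(** With the sonic slope, [v0] itself is critical, so [hug] drops below zero just to its right.
    Quasi-concavity forbids a later return to positive values. *)
Lemma hug_sonic_ray (v0 P0 v : R) :
  0 < v0 < v -> - p_inf E < P0 ->
  let m := a_h2 E v0 (s_hat E v0 P0) / v0 ^ 2 in
  - p_inf E < ray v0 P0 m v -> hug v0 P0 v (ray v0 P0 m v) <= 0.
Proof.
  intros Hv HP0 m Hr.
  assert (R0 : ray v0 P0 m v0 = P0) by (unfold ray; ring).
  destruct (rayleigh_slope v0 P0 m v0) as (T & d & HT & Hd & _ & Hrel); [lra|lra|].
  rewrite R0 in Hrel.
  destruct (Henergy v0 P0 ltac:(lra) ltac:(lra)) as (_ & _ & Hps & _).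
  set (k := Derive (fun s => p_hat E v0 s) (s_hat E v0 P0)) in *.
  assert (d = 0) as ->.
  { assert (Hz : k * (T * d) = 0).
    { unfold m, a_h2 in Hrel. set (pv := Derive (fun w => p_hat E w (s_hat E v0 P0)) v0) in *.
      replace (- (- v0 ^ 2 * pv / v0 ^ 2)) with pv in Hrel by (field; lra). lra. }
    apply Rmult_integral in Hz as [|Hz]; [lra|].
    apply Rmult_integral in Hz as [|Hz]; [lra|assumption]. }
  destruct (Rle_lt_dec (hug v0 P0 v (ray v0 P0 m v)) 0) as [|Hpos]; [assumption|exfalso].
  destruct (rayleigh_critical v0 P0 m v0 ltac:(lra) ltac:(lra) Hd (v - v0) ltac:(lra))
    as (y & Hy & Hlt).
  pose proof (rayleigh_above v0 P0 m v0 y v ltac:(lra) ltac:(lra) ltac:(lra) Hr) as Habove.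
  rewrite R0, hug_self in Hlt, Habove. rewrite Rmin_left in Habove; lra.
Qed.

(** * Shock slopes *)

Lemma xi_h_spec (W : state) (P : R) :
  admissible E W -> - p_inf E < P ->
  0 < xi_h E P W /\ hug (vol W) (ph E W) (xi_h E P W) P = 0.
Proof.
  intros [Hr HP0] HP. assert (Hv := Rinv_0_lt_compat _ Hr). fold (vol W) in Hv.
  apply (iota_correct (V := R_CompleteNormedModule)
    (fun w : R => 0 < w /\ hug (vol W) (ph E W) w P = 0)).
  destruct (hug_root (vol W) (ph E W) P Hv HP0 HP) as (w & Hw & Hw0).
  exists w. split; [now split|]. intros w' [Hw' Hw0'].
  destruct (Rtotal_order w w') as [Hlt|[|Hlt]]; [exfalso|assumption|exfalso].
  - pose proof (hug_increasing (vol W) (ph E W) w w' P Hw HP HP0 Hlt). lra.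
  - pose proof (hug_increasing (vol W) (ph E W) w' w P Hw' HP HP0 Hlt). lra.
Qed.

Lemma vol_pos (W : state) : admissible E W -> 0 < vol W.
Proof. intros [Hr _]. now apply Rinv_0_lt_compat. Qed.

Lemma xi_h_self (W : state) : admissible E W -> xi_h E (ph E W) W = vol W.
Proof.
  intros HW. pose proof (vol_pos W HW) as Hv. pose proof HW as [_ HP0].
  destruct (xi_h_spec W (ph E W) HW HP0) as [Hx H].
  pose proof (hug_self (vol W) (ph E W)) as Hs.
  destruct (Rtotal_order (xi_h E (ph E W) W) (vol W)) as [Hlt|[|Hlt]];
    [exfalso|assumption|exfalso].
  - pose proof (hug_increasing (vol W) (ph E W) _ _ _ Hx HP0 HP0 Hlt). lra.
  - pose proof (hug_increasing (vol W) (ph E W) _ _ _ Hv HP0 HP0 Hlt). lra.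
Qed.

Hypothesis Hxi : xi_h_decreasing E.

Lemma xi_h_below (W : state) (P Q : R) :
  admissible E W -> - p_inf E < P -> P <= Q -> xi_h E Q W <= xi_h E P W.
Proof.
  intros HW HP [HPQ| ->]; [|apply Rle_refl]. left. now apply (Hxi W HW).
Qed.

Lemma xi_h_compression (W : state) (P : R) :
  admissible E W -> ph E W < P -> 0 < xi_h E P W < vol W.
Proof.
  intros HW HP. pose proof HW as [_ HP0]. split; [apply xi_h_spec; [assumption|lra]|].
  rewrite <- (xi_h_self W HW). now apply Hxi.
Qed.

Lemma xi_h_expansion (W : state) (P : R) :
  admissible E W -> - p_inf E < P -> P < ph E W -> vol W < xi_h E P W.
Proof.
  intros HW HP HPW. rewrite <- (xi_h_self W HW). now apply Hxi.
Qed.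

(** The square of [Q_h] for compressions. The quotient degenerates at [P = ph E W], so it is used
    strictly above that pressure. *)
Definition slope (W : state) (P : R) : R := (P - ph E W) / (vol W - xi_h E P W).

Lemma Q_h_slope (W : state) (P : R) :
  admissible E W -> ph E W < P -> Q_h E P W = sqrt (slope W P).
Proof.
  intros HW HP. pose proof (xi_h_compression W P HW HP). unfold Q_h, slope.
  destruct (Req_EM_T P (ph E W)); [lra|]. now rewrite !Rabs_pos_eq by lra.
Qed.

Lemma slope_pos (W : state) (P : R) : admissible E W -> ph E W < P -> 0 < slope W P.
Proof.
  intros HW HP. pose proof (xi_h_compression W P HW HP).
  apply Rdiv_lt_0_compat; lra.
Qed.

Lemma slope_le (W : state) (P P' : R) :
  admissible E W -> ph E W < P <= P' -> slope W P <= slope W P'.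
Proof.
  intros HW [HP [HPP| ->]]; [|apply Rle_refl].
  pose proof HW as [_ HP0].
  pose proof (xi_h_compression W P HW HP). pose proof (xi_h_compression W P' HW ltac:(lra)).
  destruct (xi_h_spec W P HW ltac:(lra)) as [_ H1].
  destruct (xi_h_spec W P' HW ltac:(lra)) as [_ H2].
  pose proof (shock_slope_monotone (vol W) (ph E W) (xi_h E P W) P (xi_h E P' W) P' HP0
    ltac:(lra) ltac:(lra) ltac:(lra) H1 H2) as Hm.
  unfold slope.
  apply Rmult_le_reg_r with ((vol W - xi_h E P W) * (vol W - xi_h E P' W)).
  { apply Rmult_lt_0_compat; lra. }
  replace ((P - ph E W) / (vol W - xi_h E P W)
    * ((vol W - xi_h E P W) * (vol W - xi_h E P' W)))
    with ((P - ph E W) * (vol W - xi_h E P' W)) by (field; lra).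
  replace ((P' - ph E W) / (vol W - xi_h E P' W)
    * ((vol W - xi_h E P W) * (vol W - xi_h E P' W)))
    with ((P' - ph E W) * (vol W - xi_h E P W)) by (field; lra).
  exact Hm.
Qed.

Definition sound (W : state) : R := a_h2 E (vol W) (sh E W).

Lemma sound_pos (W : state) : admissible E W -> 0 < sound W.
Proof.
  intros HW. pose proof (vol_pos W HW). destruct HW as [_ HP].
  now apply (Hconvex (vol W) (ph E W)).
Qed.

Lemma sound_le_slope (W : state) (P : R) :
  admissible E W -> ph E W < P -> sound W / vol W ^ 2 <= slope W P.
Proof.
  intros HW HP. pose proof HW as [_ HP0]. pose proof (vol_pos W HW) as Hv.
  pose proof (xi_h_compression W P HW HP) as Hx.
  destruct (xi_h_spec W P HW ltac:(lra)) as [_ H].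
  pose proof (shock_slope_ge_sound (vol W) (ph E W) _ P HP0 HP Hx H) as Hs.
  assert (0 < vol W ^ 2) by now apply pow_lt.
  unfold slope.
  apply Rmult_le_reg_r with (vol W ^ 2 * (vol W - xi_h E P W)).
  { apply Rmult_lt_0_compat; lra. }
  replace (sound W / vol W ^ 2 * (vol W ^ 2 * (vol W - xi_h E P W)))
    with (sound W * (vol W - xi_h E P W)) by (field; lra).
  replace ((P - ph E W) / (vol W - xi_h E P W) * (vol W ^ 2 * (vol W - xi_h E P W)))
    with (vol W ^ 2 * (P - ph E W)) by (field; lra).
  exact Hs.
Qed.

(* At [P = ph E W], [Lim] samples [Q] along a sequence decreasing to [ph E W],
   on which [Q] is bounded above, so that [real] does not meet [p_infty]. *)
Lemma Q_h_ge_sound (W : state) (P : R) :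
  admissible E W -> ph E W <= P ->
  0 <= Q_h E P W /\ sound W <= (vol W * Q_h E P W) ^ 2.
Proof.
  intros HW HP. pose proof (vol_pos W HW) as Hv. pose proof (sound_pos W HW) as Hs.
  assert (Hv2 : 0 < vol W ^ 2) by now apply pow_lt.
  assert (Hsv : 0 < sound W / vol W ^ 2) by now apply Rdiv_lt_0_compat.
  enough (Hq : sqrt (sound W / vol W ^ 2) <= Q_h E P W).
  { pose proof (sqrt_pos (sound W / vol W ^ 2)). split; [lra|].
    assert (Hsq : sqrt (sound W / vol W ^ 2) ^ 2 <= Q_h E P W ^ 2) by (apply pow_incr; lra).
    rewrite pow2_sqrt in Hsq by lra.
    apply Rmult_le_compat_l with (r := vol W ^ 2) in Hsq; [|lra].
    replace (vol W ^ 2 * (sound W / vol W ^ 2)) with (sound W) in Hsq by (field; lra).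
    rewrite Rpow_mult_distr. exact Hsq. }
  destruct HP as [HP| <-].
  { rewrite Q_h_slope by assumption. apply sqrt_le_1_alt. now apply sound_le_slope. }
  unfold Q_h. destruct (Req_EM_T (ph E W) (ph E W)) as [_|]; [|contradiction].
  unfold Lim, Rbar_loc_seq.
  set (u := fun n => _).
  assert (Hu : forall n, u n = sqrt (slope W (ph E W + / (INR n + 1)))).
  { intros n. pose proof (pos_INR n).
    assert (0 < / (INR n + 1)) by (apply Rinv_0_lt_compat; lra).
    pose proof (xi_h_compression W (ph E W + / (INR n + 1)) HW ltac:(lra)).
    unfold u, slope. now rewrite !Rabs_pos_eq by lra. }
  assert (Hlow : Rbar_le (Lim_seq (fun _ => sqrt (sound W / vol W ^ 2))) (Lim_seq u)).
  { apply Lim_seq_le_loc. exists 0%nat. intros n _. rewrite Hu. apply sqrt_le_1_alt.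
    pose proof (pos_INR n).
    assert (0 < / (INR n + 1)) by (apply Rinv_0_lt_compat; lra).
    apply sound_le_slope; [assumption|lra]. }
  assert (Hup : Rbar_le (Lim_seq u) (Lim_seq (fun _ => sqrt (slope W (ph E W + 1))))).
  { apply Lim_seq_le_loc. exists 0%nat. intros n _. rewrite Hu. apply sqrt_le_1_alt.
    pose proof (pos_INR n).
    assert (0 < / (INR n + 1)) by (apply Rinv_0_lt_compat; lra).
    assert (/ (INR n + 1) <= / 1) by (apply Rinv_le_contravar; lra).
    rewrite Rinv_1 in *. apply slope_le; [assumption|lra]. }
  rewrite Lim_seq_const in Hlow, Hup.
  destruct (Lim_seq u); simpl in *; [assumption|contradiction|contradiction].
Qed.

(** Monotonicity of the shock slope, multiplied out so as to include [P = ph E W], where both sides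
    vanish. *)
Lemma Q_h_chord (W : state) (P Q : R) :
  admissible E W -> ph E W <= P <= Q ->
  P - ph E W <= Q_h E Q W ^ 2 * (vol W - xi_h E P W).
Proof.
  intros HW [[HP| <-] HPQ].
  - pose proof (xi_h_compression W P HW HP).
    pose proof (slope_pos W Q HW ltac:(lra)).
    rewrite Q_h_slope, pow2_sqrt by (assumption || lra).
    replace (P - ph E W) with (slope W P * (vol W - xi_h E P W))
      by (unfold slope; field; lra).
    apply Rmult_le_compat_r; [lra|]. now apply slope_le.
  - rewrite xi_h_self by assumption. lra.
Qed.

(** * The binding pressure *)

Hypothesis Hbind : binding_eos E.

Lemma p_b_derive (r : R) : 0 < r -> is_derive (p_b E) r (a_b2 E r).
Proof.
  intros Hr. destruct (Hbind r Hr) as (Hd & _ & _).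
  apply Derive_correct. unfold p_b. auto_derive. exact (Hd 2%nat ltac:(lia)).
Qed.

(** The third derivative of [e_b] enters here. The resulting continuity yields the existence of the
    maximum [M] and the integrability along fans. *)
Lemma a_b2_ex_derive (r : R) : 0 < r -> ex_derive (a_b2 E) r.
Proof.
  intros Hr.
  apply (ex_derive_ext_loc (fun x => 2 * x * Derive (e_b E) x
    + x ^ 2 * Derive_n (e_b E) 2 x)).
  - exists (mkposreal r Hr). intros x Hx.
    change (Rabs (x - r) < r) in Hx. apply Rabs_def2 in Hx.
    destruct (Hbind x ltac:(lra)) as (Hd & _ & _).
    symmetry. apply is_derive_unique. unfold p_b. auto_derive.
    + exact (Hd 2%nat ltac:(lia)).
    + simpl. change (Derive (fun x => Derive (fun x => e_b E x) x) x)
        with (Derive (Derive (e_b E)) x).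
      change (Derive (fun x => Derive (e_b E) x) x) with (Derive (Derive (e_b E)) x). ring.
  - destruct (Hbind r Hr) as (Hd & _ & _).
    auto_derive. split; [exact (Hd 2%nat ltac:(lia))|].
    split; [exact (Hd 3%nat ltac:(lia))|exact I].
Qed.

Lemma a_b2_hat_ex_derive (v : R) : 0 < v -> ex_derive (a_b2_hat E) v.
Proof.
  intros Hv. assert (Hi := Rinv_0_lt_compat _ Hv).
  unfold a_b2_hat. auto_derive. split; [now apply a_b2_ex_derive|]. split; [lra|exact I].
Qed.

Lemma p_b_hat_derive (v : R) :
  0 < v -> is_derive (p_b_hat E) v (- (a_b2_hat E v / v ^ 2)).
Proof.
  intros Hv. assert (Hi := Rinv_0_lt_compat _ Hv).
  pose proof (p_b_derive (/ v) Hi) as H.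
  unfold p_b_hat. auto_derive.
  - split; [now exists (a_b2 E (/ v))|]. split; [lra|exact I].
  - change (Derive (fun x => p_b E x)) with (a_b2 E). unfold a_b2_hat. field. lra.
Qed.

Lemma e_b_hat_derive (v : R) : 0 < v -> is_derive (e_b_hat E) v (- p_b_hat E v).
Proof.
  intros Hv. assert (Hi := Rinv_0_lt_compat _ Hv).
  destruct (Hbind (/ v) Hi) as (Hd & _ & _).
  unfold e_b_hat. auto_derive.
  - split; [exact (Hd 1%nat ltac:(lia))|]. split; [lra|exact I].
  - unfold p_b_hat, p_b. change (Derive (fun x => e_b E x)) with (Derive (e_b E)). field. lra.
Qed.

Lemma a_b2_hat_nonneg (v : R) : 0 < v -> 0 <= a_b2_hat E v.
Proof. intros Hv. apply Hbind. now apply Rinv_0_lt_compat. Qed.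

Lemma p_b_hat_decreasing (v w : R) : 0 < v -> v <= w -> p_b_hat E w <= p_b_hat E v.
Proof.
  intros Hv [Hvw| ->]; [|apply Rle_refl].
  destruct (MVT_cor2 (p_b_hat E) (fun c => - (a_b2_hat E c / c ^ 2)) v w Hvw)
    as (c & Hc & Hcb).
  { intros c Hc. apply is_derive_Reals, p_b_hat_derive. lra. }
  pose proof (a_b2_hat_nonneg c ltac:(lra)).
  assert (0 < c ^ 2) by (apply pow_lt; lra).
  assert (0 <= a_b2_hat E c / c ^ 2) by (apply Rdiv_le_0_compat; lra).
  assert (0 <= a_b2_hat E c / c ^ 2 * (w - v)) by (apply Rmult_le_pos; lra). lra.
Qed.

Lemma p_b_hat_lipschitz (v w M : R) :
  0 < v -> v <= w -> (forall t, v <= t <= w -> a_b2_hat E t / t ^ 2 <= M) ->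
  p_b_hat E v - p_b_hat E w <= M * (w - v).
Proof.
  intros Hv [Hvw| ->] HM; [|lra].
  destruct (MVT_cor2 (p_b_hat E) (fun c => - (a_b2_hat E c / c ^ 2)) v w Hvw)
    as (c & Hc & Hcb).
  { intros c Hc. apply is_derive_Reals, p_b_hat_derive. lra. }
  specialize (HM c ltac:(lra)).
  assert (a_b2_hat E c / c ^ 2 * (w - v) <= M * (w - v)) by (apply Rmult_le_compat_r; lra).
  lra.
Qed.

Lemma A_b_swap (v w : R) : A_b E v w = - A_b E w v.
Proof. unfold A_b. ring. Qed.

(* [A_b] is the error of the trapezoidal rule for the monotone [p_b_hat]. *)
Lemma A_b_bound (v w : R) :
  0 < v -> v <= w -> Rabs (A_b E w v) <= / 2 * (p_b_hat E v - p_b_hat E w) * (w - v).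
Proof.
  intros Hv [Hvw| ->].
  2: { unfold A_b. rewrite !Rminus_diag, !Rmult_0_r, Rplus_0_l, Rabs_R0. apply Rle_refl. }
  (* The energy difference is [- p_b_hat E c * (w - v)]. A value between the end values differs from
     their average by at most half the jump, whence the factor [/ 2]. *)
  destruct (MVT_cor2 (e_b_hat E) (fun c => - p_b_hat E c) v w Hvw) as (c & Hc & Hcb).
  { intros c Hc. apply is_derive_Reals, e_b_hat_derive. lra. }
  pose proof (p_b_hat_decreasing v c Hv ltac:(lra)).
  pose proof (p_b_hat_decreasing c w ltac:(lra) ltac:(lra)).
  unfold A_b. rewrite Hc. apply Rabs_le. split; nra.
Qed.

(** * Slopes of shocks of the full equation of state *)

Lemma pres_ph (W : state) : pres W = ph E W + p_b_hat E (vol W).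
Proof. unfold ph. ring. Qed.

(** The disjunction is what the opposite wave provides: a bound on the squared velocity jump, which
    is the product of the jumps of pressure and volume, or a bound on the pressure jump. Inside the
    range of [M], the jump of [p_b_hat] costs one [M], so the hydrodynamical jump may exceed
    [Q_h E q W0 ^ 2] times the volume jump by one more. *)
Lemma compressive_shock_slope (W0 W1 : state) (q M : R) :
  admissible E W0 -> admissible E W1 -> hugoniot E W0 W1 ->
  ph E W0 <= ph E W1 -> vol W1 < vol W0 -> ph E W0 <= q ->
  (forall t, xi_h E q W0 <= t <= vol W0 -> a_b2_hat E t / t ^ 2 <= M) ->
  (pres W1 - pres W0) * (vol W0 - vol W1) <= (q - ph E W0) * (vol W0 - xi_h E q W0) \/
  pres W1 - pres W0 <= q - ph E W0 ->
  pres W1 - pres W0 <= (Q_h E q W0 ^ 2 + 2 * M) * (vol W0 - vol W1).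
Proof.
  intros HW0 HW1 [Hhug _] HP Hv Hq HM Hbound.
  pose proof HW0 as [_ HP0]. pose proof HW1 as [_ HP1].
  pose proof (vol_pos W0 HW0) as Hv0. pose proof (vol_pos W1 HW1) as Hv1.
  pose proof (p_b_hat_decreasing (vol W1) (vol W0) Hv1 ltac:(lra)) as HD.
  pose proof (A_b_bound (vol W1) (vol W0) Hv1 ltac:(lra)) as HA.
  rewrite A_b_swap, Rabs_Ropp in HA. apply Rabs_le_between in HA.
  change (hug (vol W0) (ph E W0) (vol W1) (ph E W1) + A_b E (vol W1) (vol W0) = 0) in Hhug.
  rewrite !pres_ph in *.
  set (x := vol W0 - vol W1) in *.
  set (D := p_b_hat E (vol W1) - p_b_hat E (vol W0)) in *.
  set (y := vol W0 - xi_h E q W0) in *.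
  assert (HxiqW : xi_h E q W0 <= vol W0).
  { rewrite <- (xi_h_self W0 HW0). now apply xi_h_below. }
  assert (HM0 : 0 <= M).
  { specialize (HM (vol W0) ltac:(lra)).
    pose proof (a_b2_hat_nonneg (vol W0) Hv0).
    assert (0 < vol W0 ^ 2) by now apply pow_lt.
    assert (0 <= a_b2_hat E (vol W0) / vol W0 ^ 2) by (apply Rdiv_le_0_compat; lra). lra. }
  pose proof (pow2_ge_0 (Q_h E q W0)) as Hc0.
  pose proof (Q_h_chord W0 q q HW0 ltac:(lra)) as Hchq. fold y in Hchq.
  set (c := Q_h E q W0 ^ 2) in *.
  assert (Hx : 0 < x) by (unfold x; lra).
  assert (Hy : 0 <= y) by (unfold y; lra).
  replace (ph E W1 + p_b_hat E (vol W1) - (ph E W0 + p_b_hat E (vol W0)))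
    with (ph E W1 - ph E W0 + D) in * by (unfold D; ring).
  assert (HD0 : 0 <= D) by (unfold D; lra).
  set (p := ph E W1 - ph E W0) in *.
  assert (Hp0 : 0 <= p) by (unfold p; lra).
  destruct (Rlt_le_dec y x) as [Hyx|Hxy].
  - (* the shock leaves the range of [M], but then its slope is below [c] *)
    assert (H1 : p + D <= c * x).
    { assert (c * y <= c * x) by (apply Rmult_le_compat_l; lra).
      destruct Hbound as [Hb|Hb]; [|lra].
      assert ((q - ph E W0) * y <= c * x * x) by (apply Rmult_le_compat; lra).
      apply Rmult_le_reg_r with x; lra. }
    assert (0 <= 2 * M * x) by (apply Rmult_le_pos; lra). lra.
  - assert (HDM : D <= M * x).
    { apply p_b_hat_lipschitz; [assumption|lra|]. intros t Ht. apply HM. unfold x, y in *. lra. }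
    destruct (xi_h_spec W0 (ph E W1) HW0 HP1) as [Hz Hz0].
    set (z := xi_h E (ph E W1) W0) in *.
    (* comparison with the hydrodynamical shock of the same hydrodynamical pressure *)
    assert (Hcomp : vol W1 <= z \/ p * (vol W1 - z) <= D * x).
    { destruct (Rle_lt_dec (vol W1) z) as [|Hlt]; [now left|right].
      pose proof (hug_growth (vol W0) (ph E W0) z (vol W1) (ph E W1) Hz HP1 ltac:(lra)) as Hg.
      (* The growth coefficient exceeds [/ 2 * p] by [p_inf E + ph E W0], which is positive. The
         factor [/ 2] cancels against the one in the bound of [A_b]. *)
      assert (/ 2 * p * (vol W1 - z)
        <= (p_inf E + / 2 * (ph E W1 + ph E W0)) * (vol W1 - z))
        by (apply Rmult_le_compat_r; unfold p; lra).
      fold D x in HA. lra. }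
    (* Above [q], the hydrodynamical shock to [ph E W1] would have a product of jumps larger than at
       [q]. By [Hcomp] that product is at most [(p + D) * x], the product for the full shock,
       contradicting the first alternative. *)
    assert (Hpq : ph E W1 <= q).
    { destruct (Rle_lt_dec (ph E W1) q) as [|Hlt]; [assumption|exfalso].
      destruct Hbound as [Hb|Hb]; [|unfold p in *; lra].
      assert (z < xi_h E q W0) by (apply Hxi; [assumption|lra|assumption]).
      assert (Hb1 : p * (vol W0 - z) <= (p + D) * x).
      { replace (vol W0 - z) with (x + (vol W1 - z)) by (unfold x; ring).
        destruct Hcomp as [Hle|Hle]; [|lra].
        assert (p * (z - vol W1) >= 0) by (apply Rle_ge, Rmult_le_pos; lra).
        assert (0 <= D * x) by (apply Rmult_le_pos; lra). lra. }
      assert ((q - ph E W0) * y < p * (vol W0 - z)).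
      { apply Rle_lt_trans with ((q - ph E W0) * (vol W0 - z)).
        - apply Rmult_le_compat_l; unfold y; lra.
        - apply Rmult_lt_compat_r; unfold p, y in *; lra. }
      lra. }
    pose proof (Q_h_chord W0 (ph E W1) q HW0 ltac:(lra)) as Hch.
    fold c p z in Hch.
    enough (p <= (c + M) * x) by lra.
    assert (HMx : 0 <= M * x) by (apply Rmult_le_pos; lra).
    destruct Hcomp as [Hle|Hle].
    + assert (c * (vol W0 - z) <= c * x) by (apply Rmult_le_compat_l; unfold x; lra). lra.
    + destruct (Rle_lt_dec (vol W1) z) as [Hle'|Hlt].
      * assert (c * (vol W0 - z) <= c * x) by (apply Rmult_le_compat_l; unfold x; lra). lra.
      (* Split [p * Y] into [p * x] and [p * (Y - x)]. The first is at most [c * Y * x] by the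
         chord, the second at most [M * x * Y] since [x < Y]; then divide by [Y]. *)
      * set (Y := vol W0 - z) in *.
        assert (HY : x < Y) by (unfold x, Y; lra).
        replace (vol W1 - z) with (Y - x) in Hle by (unfold x, Y; ring).
        apply Rmult_le_reg_r with Y; [lra|].
        assert (D * x <= M * x * x) by (apply Rmult_le_compat_r; lra).
        assert (M * x * x <= M * x * Y) by (apply Rmult_le_compat_l; lra).
        assert (p * x <= c * Y * x) by (apply Rmult_le_compat_r; lra).
        lra.
Qed.

Lemma expansion_chord (W : state) (P : R) :
  admissible E W -> - p_inf E < P -> P <= ph E W ->
  ph E W - P <= sound W / vol W ^ 2 * (xi_h E P W - vol W).
Proof.
  intros HW HP [HPW| ->]; [|rewrite xi_h_self by assumption; lra].
  pose proof (vol_pos W HW) as Hv. assert (0 < vol W ^ 2) by now apply pow_lt.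
  pose proof (xi_h_expansion W P HW HP HPW) as Hx.
  destruct (xi_h_spec W P HW HP) as [_ Hz].
  pose proof (expansion_slope_le_sound (vol W) (ph E W) _ P Hv ltac:(lra) Hx Hz) as Hs.
  change (a_h2 E (vol W) (s_hat E (vol W) (ph E W))) with (sound W) in Hs.
  apply Rmult_le_reg_l with (vol W ^ 2); [assumption|].
  replace (vol W ^ 2 * (sound W / vol W ^ 2 * (xi_h E P W - vol W)))
    with (sound W * (xi_h E P W - vol W)) by (field; lra).
  exact Hs.
Qed.

(** The reference slope is the sonic one: hydrodynamical expansion slopes do not exceed it, and it
    is itself dominated by [Q_h] at every compressive pressure. Thus one [Q_h] serves both types of
    wave. *)
Lemma expansive_shock_slope (W0 W1 : state) (q M : R) :
  admissible E W0 -> admissible E W1 -> hugoniot E W0 W1 ->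
  ph E W1 <= ph E W0 -> vol W0 < vol W1 -> - p_inf E < q -> q <= ph E W0 ->
  (forall t, vol W0 <= t <= xi_h E q W0 -> a_b2_hat E t / t ^ 2 <= M) ->
  (pres W0 - pres W1) * (vol W1 - vol W0) <= (ph E W0 - q) * (xi_h E q W0 - vol W0) \/
  pres W0 - pres W1 <= ph E W0 - q ->
  pres W0 - pres W1 <= (sound W0 / vol W0 ^ 2 + 2 * M) * (vol W1 - vol W0).
Proof.
  intros HW0 HW1 [Hhug _] HP Hv Hq0 Hq HM Hbound.
  pose proof HW0 as [_ HP0]. pose proof HW1 as [_ HP1].
  pose proof (vol_pos W0 HW0) as Hv0. pose proof (vol_pos W1 HW1) as Hv1.
  pose proof (p_b_hat_decreasing (vol W0) (vol W1) Hv0 ltac:(lra)) as HD.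
  pose proof (A_b_bound (vol W0) (vol W1) Hv0 ltac:(lra)) as HA.
  apply Rabs_le_between in HA.
  change (hug (vol W0) (ph E W0) (vol W1) (ph E W1) + A_b E (vol W1) (vol W0) = 0) in Hhug.
  pose proof (expansion_chord W0 q HW0 Hq0 Hq) as Hchq.
  rewrite !pres_ph in *.
  set (x := vol W1 - vol W0) in *.
  set (D := p_b_hat E (vol W0) - p_b_hat E (vol W1)) in *.
  set (y := xi_h E q W0 - vol W0) in *.
  assert (Hy : 0 <= y).
  { pose proof (xi_h_below W0 q (ph E W0) HW0 Hq0 Hq) as Hle.
    rewrite (xi_h_self W0 HW0) in Hle. unfold y. lra. }
  assert (Hv2 : 0 < vol W0 ^ 2) by now apply pow_lt.
  assert (HM0 : 0 <= M).
  { specialize (HM (vol W0) ltac:(unfold y in *; lra)).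
    pose proof (a_b2_hat_nonneg (vol W0) Hv0).
    assert (0 <= a_b2_hat E (vol W0) / vol W0 ^ 2) by (apply Rdiv_le_0_compat; lra). lra. }
  pose proof (sound_pos W0 HW0) as Hsp.
  assert (Hc0 : 0 < sound W0 / vol W0 ^ 2) by now apply Rdiv_lt_0_compat.
  set (c := sound W0 / vol W0 ^ 2) in *.
  assert (Hx : 0 < x) by (unfold x; lra).
  replace (ph E W0 + p_b_hat E (vol W0) - (ph E W1 + p_b_hat E (vol W1)))
    with (ph E W0 - ph E W1 + D) in * by (unfold D; ring).
  assert (HD0 : 0 <= D) by (unfold D; lra).
  set (p := ph E W0 - ph E W1) in *.
  assert (HMx : 0 <= M * x) by (apply Rmult_le_pos; lra).
  destruct (Rlt_le_dec y x) as [Hyx|Hxy].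
  - assert (H1 : p + D <= c * x).
    { assert (c * y <= c * x) by (apply Rmult_le_compat_l; lra).
      destruct Hbound as [Hb|Hb]; [|lra].
      assert ((ph E W0 - q) * y <= c * x * x) by (apply Rmult_le_compat; lra).
      apply Rmult_le_reg_r with x; lra. }
    lra.
  - assert (HDM : D <= M * x).
    { apply p_b_hat_lipschitz; [assumption|lra|]. intros t Ht. apply HM. unfold x, y in *. lra. }
    enough (p <= (c + M) * x) by lra.
    (* In the remaining case the sonic line at [vol W1] lies above [ph E W1], so its pressure is
       admissible. *)
    destruct (Rle_lt_dec p (c * x)) as [|Hpc]; [lra|].
    assert (Hray : ray (vol W0) (ph E W0) c (vol W1) = ph E W0 - c * x)
      by (unfold ray, x; ring).
    assert (HPr : ph E W1 < ph E W0 - c * x) by (unfold p in *; lra).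
    (* the isentropic slope bounds the hydrodynamical Hugoniot locus from below *)
    pose proof (hug_sonic_ray (vol W0) (ph E W0) (vol W1) ltac:(lra) HP0) as Hson.
    cbv zeta in Hson. change (a_h2 E (vol W0) (s_hat E (vol W0) (ph E W0)) / vol W0 ^ 2)
      with c in Hson.
    rewrite Hray in Hson. specialize (Hson ltac:(lra)).
    pose proof (e_hat_monotone (vol W1) (ph E W1) (ph E W0 - c * x) Hv1 HP1 ltac:(lra)) as He.
    unfold hug in Hson, Hhug. fold x in Hson, Hhug.
    (* At fixed volume [vol W1], going down from the sonic line to [ph E W1] lowers [hug] by at
       least [/ 2 * (p - c * x) * x], while [A_b] compensates at most [/ 2 * D * x]. *)
    assert (Hk : (p - c * x) * x <= D * x) by (unfold p; fold D in HA; lra).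
    apply Rmult_le_reg_r in Hk; lra.
Qed.

(** * Velocity and pressure across elementary waves *)

Lemma c2_continuous (r s P : R) :
  0 < r -> - p_inf E < P -> s_hat E (/ r) P = s ->
  continuous (fun x => c2 E (/ x) s) r.
Proof.
  intros Hr HP <-. assert (Hi := Rinv_0_lt_compat _ Hr).
  pose proof (ex_diff_n_deriv_aux1 _ 1 _ _ (p_hat_C2 E HE (/ r) P Hi HP)) as (_ & Hex & _).
  assert (Ha : ex_derive (fun v => c2 E v (s_hat E (/ r) P)) (/ r)).
  { unfold c2, a_h2. pose proof (a_b2_hat_ex_derive (/ r) Hi).
    auto_derive. split; [exact Hex|]. split; [assumption|exact I]. }
  apply (ex_derive_continuous (K := R_AbsRing) (V := R_NormedModule)).
  apply (ex_derive_comp (fun v => c2 E v (s_hat E (/ r) P)) Rinv); [exact Ha|].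
  auto_derive. lra.
Qed.

Lemma vol_le_rho (W W' : state) :
  admissible E W -> admissible E W' -> vol W <= vol W' -> rho W' <= rho W.
Proof.
  intros [Hr _] [Hr' _] Hv. unfold vol in Hv.
  rewrite <- (Rinv_inv (rho W)), <- (Rinv_inv (rho W')).
  apply Rinv_le_contravar; [now apply Rinv_0_lt_compat|assumption].
Qed.

Lemma fan_integrable (W0 W1 : state) :
  admissible E W0 -> admissible E W1 -> fan E W0 W1 ->
  ex_RInt (fun x => / x * sqrt (c2 E (/ x) (sh E W0))) (rho W0) (rho W1).
Proof.
  intros [Hr0 _] [Hr1 _] (_ & _ & Hisen & _).
  apply (ex_RInt_continuous (V := R_CompleteNormedModule)). intros r Hr.
  assert (0 < r) by (pose proof (Rmin_glb_lt _ _ _ Hr0 Hr1); lra).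
  (* Regularity of [p_hat] is available only at entropies attained at admissible pressures; the
     isentrope clause of [fan] supplies such a pressure at each density. *)
  destruct (Hisen r Hr) as (P & HP & Hs).
  apply (continuous_mult (K := R_AbsRing)).
  - apply (ex_derive_continuous (K := R_AbsRing) (V := R_NormedModule)). auto_derive. lra.
  - apply (continuous_comp (fun x => c2 E (/ x) (sh E W0)) sqrt).
    + now apply c2_continuous with P.
    + apply continuous_sqrt.
Qed.

Lemma fan_integrand_nonneg (s x : R) : 0 < x -> 0 <= / x * sqrt (c2 E (/ x) s).
Proof.
  intros Hx. apply Rmult_le_pos; [left; now apply Rinv_0_lt_compat|apply sqrt_pos].
Qed.

Lemma compressive_fan_vel (W0 W1 : state) :
  admissible E W0 -> admissible E W1 -> fan E W0 W1 -> vol W1 <= vol W0 ->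
  vel W1 <= vel W0.
Proof.
  intros HW0 HW1 Hfan Hv. pose proof (fan_integrable W0 W1 HW0 HW1 Hfan) as Hex.
  pose proof (vol_le_rho W1 W0 HW1 HW0 Hv) as Hrho.
  destruct Hfan as (_ & -> & _). unfold fan_vel.
  enough (0 <= RInt (fun x => / x * sqrt (c2 E (/ x) (sh E W0))) (rho W0) (rho W1)) by lra.
  apply RInt_ge_0; [assumption..|]. intros x Hx. apply fan_integrand_nonneg.
  destruct HW0. lra.
Qed.

Lemma expansive_fan_vel (W0 W1 : state) :
  admissible E W0 -> admissible E W1 -> fan E W0 W1 -> vol W0 <= vol W1 ->
  vel W0 <= vel W1.
Proof.
  intros HW0 HW1 Hfan Hv. pose proof (fan_integrable W0 W1 HW0 HW1 Hfan) as Hex.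
  pose proof (vol_le_rho W0 W1 HW0 HW1 Hv) as Hrho.
  destruct Hfan as (_ & -> & _). unfold fan_vel.
  pose proof (opp_RInt_swap (V := R_CompleteNormedModule) _ _ _ Hex) as Hsw.
  enough (0 <= RInt (fun x => / x * sqrt (c2 E (/ x) (sh E W0))) (rho W1) (rho W0)).
  { rewrite <- Hsw in H. change (0 <= - RInt (fun x => / x * sqrt (c2 E (/ x) (sh E W0)))
      (rho W0) (rho W1)) in H. lra. }
  apply RInt_ge_0; [assumption|now apply ex_RInt_swap|].
  intros x Hx. apply fan_integrand_nonneg. destruct HW1. lra.
Qed.

Lemma compressive_pres (W0 W1 : state) :
  admissible E W0 -> admissible E W1 ->
  ph E W0 <= ph E W1 -> vol W1 <= vol W0 -> pres W0 <= pres W1.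
Proof.
  intros HW0 HW1 HP Hv. rewrite !pres_ph.
  pose proof (p_b_hat_decreasing (vol W1) (vol W0) (vol_pos W1 HW1) Hv). lra.
Qed.

Lemma f_S_compressive (W0 W1 : state) :
  pres W0 <= pres W1 -> vol W1 <= vol W0 ->
  f_S W0 W1 = sqrt ((pres W1 - pres W0) * (vol W0 - vol W1)).
Proof.
  intros HP Hv. unfold f_S. destruct (Rle_dec (pres W0) (pres W1)); [|contradiction].
  rewrite !Rabs_pos_eq, sqrt_mult by lra. ring.
Qed.

Lemma f_S_expansive (W0 W1 : state) :
  pres W1 <= pres W0 -> vol W0 <= vol W1 ->
  f_S W0 W1 = - sqrt ((pres W0 - pres W1) * (vol W1 - vol W0)).
Proof.
  intros HP Hv. unfold f_S.
  rewrite (Rabs_minus_sym (pres W1)), (Rabs_minus_sym (vol W0)), !Rabs_pos_eq by lra.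
  rewrite sqrt_mult by lra.
  (* Only equal pressures reach the plus branch here, and then both signs give zero. *)
  destruct (Rle_dec (pres W0) (pres W1)); [|ring].
  replace (pres W0 - pres W1) with 0 by lra. rewrite sqrt_0. ring.
Qed.

(** * Waves *)

Lemma compressive_step (w : wave) (W Ws : state) (k : nat) :
  left_wave E w W Ws -> compressive E w -> (k < len w)%nat ->
  vel (st w (S k)) <= vel (st w k) /\ pres (st w k) <= pres (st w (S k)).
Proof.
  intros Hw Hc Hk. destruct (Hc k Hk) as [HP Hv].
  pose proof (lw_admissible E w W Ws Hw k ltac:(lia)) as H0.
  pose proof (lw_admissible E w W Ws Hw (S k) ltac:(lia)) as H1.
  pose proof (compressive_pres _ _ H0 H1 HP Hv) as Hpres. split; [|assumption].
  destruct (kind w k) eqn:Hkind.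
  - destruct (lw_shock E w W Ws Hw k Hk Hkind) as [[_ [_ ->]] _].
    rewrite f_S_compressive by assumption.
    pose proof (sqrt_pos ((pres (st w (S k)) - pres (st w k)) * (vol (st w k) - vol (st w (S k))))).
    lra.
  - destruct (lw_fan E w W Ws Hw k Hk Hkind) as [Hfan _]. now apply compressive_fan_vel.
Qed.

Lemma expansive_step (w : wave) (W Ws : state) (k : nat) :
  left_wave E w W Ws -> expansive E w -> (k < len w)%nat ->
  vel (st w k) <= vel (st w (S k)) /\ pres (st w (S k)) <= pres (st w k).
Proof.
  intros Hw Hc Hk. destruct (Hc k Hk) as [HP Hv].
  pose proof (lw_admissible E w W Ws Hw k ltac:(lia)) as H0.
  pose proof (lw_admissible E w W Ws Hw (S k) ltac:(lia)) as H1.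
  pose proof (compressive_pres _ _ H1 H0 HP Hv) as Hpres. split; [|assumption].
  destruct (kind w k) eqn:Hkind.
  - destruct (lw_shock E w W Ws Hw k Hk Hkind) as [[_ [_ ->]] _].
    rewrite f_S_expansive by assumption.
    pose proof (sqrt_pos ((pres (st w k) - pres (st w (S k))) * (vol (st w (S k)) - vol (st w k)))).
    lra.
  - destruct (lw_fan E w W Ws Hw k Hk Hkind) as [Hfan _]. now apply expansive_fan_vel.
Qed.

Lemma nat_monotone (f : nat -> R) (n k : nat) :
  (forall j, (j < n)%nat -> f j <= f (S j)) -> (k <= n)%nat -> f k <= f n.
Proof.
  induction n as [|n IH]; intros Hf Hk.
  - replace k with 0%nat by lia. apply Rle_refl.
  - destruct (Nat.eq_dec k (S n)) as [->|]; [apply Rle_refl|].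
    apply Rle_trans with (f n); [|apply Hf; lia]. apply IH; [|lia]. intros j Hj. apply Hf. lia.
Qed.

Lemma compressive_tail (w : wave) (W Ws : state) (k : nat) :
  left_wave E w W Ws -> compressive E w -> (k <= len w)%nat ->
  vel Ws <= vel (st w k) /\ pres (st w k) <= pres Ws.
Proof.
  intros Hw Hc Hk. rewrite <- (lw_last E w W Ws Hw). split.
  - enough (- vel (st w k) <= - vel (st w (len w))) by lra.
    apply (nat_monotone (fun j => - vel (st w j))); [|assumption].
    intros j Hj. destruct (compressive_step w W Ws j Hw Hc Hj). lra.
  - apply (nat_monotone (fun j => pres (st w j))); [|assumption].
    intros j Hj. now destruct (compressive_step w W Ws j Hw Hc Hj).
Qed.

Lemma expansive_tail (w : wave) (W Ws : state) (k : nat) :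
  left_wave E w W Ws -> expansive E w -> (k <= len w)%nat ->
  vel (st w k) <= vel Ws /\ pres Ws <= pres (st w k).
Proof.
  intros Hw Hc Hk. rewrite <- (lw_last E w W Ws Hw). split.
  - apply (nat_monotone (fun j => vel (st w j))); [|assumption].
    intros j Hj. now destruct (expansive_step w W Ws j Hw Hc Hj).
  - enough (- pres (st w k) <= - pres (st w (len w))) by lra.
    apply (nat_monotone (fun j => - pres (st w j))); [|assumption].
    intros j Hj. destruct (expansive_step w W Ws j Hw Hc Hj). lra.
Qed.

Lemma le_of_sqrt_le (a b u : R) : 0 <= b -> sqrt a <= u -> u <= sqrt b -> a <= b.
Proof.
  intros Hb H1 H2.
  destruct (Rle_lt_dec a b) as [|Hlt]; [assumption|exfalso].
  pose proof (sqrt_lt_1_alt b a ltac:(lra)). lra.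
Qed.

(* Velocity and pressure are monotone along the wave, so the jumps to [Ws]
   bound those across the first elementary wave, which alone sets the speed. *)
Lemma left_wave_speed (w : wave) (W Ws : state) (q q' M : R) :
  left_wave E w W Ws -> compressive E w \/ expansive E w ->
  - p_inf E < q' -> q' <= ph E W <= q ->
  (forall t, xi_h E q W <= t <= xi_h E q' W -> a_b2_hat E t / t ^ 2 <= M) ->
  vel W - vel Ws <= sqrt ((q - ph E W) * (vol W - xi_h E q W)) \/
    pres Ws - pres W <= q - ph E W ->
  vel Ws - vel W <= sqrt ((ph E W - q') * (xi_h E q' W - vol W)) \/
    pres W - pres Ws <= ph E W - q' ->
  vel W - sqrt ((vol W * Q_h E q W) ^ 2 + 2 * vol W ^ 2 * M) <= head_speed E w 0.
Proof.
  intros Hw Hce Hq' [Hq'W HqW] HM Hcomp Hexp.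
  pose proof (lw_len E w W Ws Hw) as Hlen.
  assert (HW : admissible E W).
  { rewrite <- (lw_first E w W Ws Hw). apply (lw_admissible E w W Ws Hw). lia. }
  pose proof (lw_admissible E w W Ws Hw 1 Hlen) as HW1.
  pose proof HW as [_ HP0]. pose proof (vol_pos W HW) as Hv.
  assert (Hv2 : 0 < vol W ^ 2) by now apply pow_lt.
  destruct (Q_h_ge_sound W q HW HqW) as [HQ Hsound].
  pose proof (xi_h_below W _ _ HW HP0 HqW) as Hxq.
  pose proof (xi_h_below W _ _ HW Hq' Hq'W) as Hxq'.
  rewrite (xi_h_self W HW) in Hxq, Hxq'.
  assert (Hslope : forall D x, 0 < x -> D <= (Q_h E q W ^ 2 + 2 * M) * x ->
    vel W - sqrt ((vol W * Q_h E q W) ^ 2 + 2 * vol W ^ 2 * M)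
      <= vel W - vol W * sqrt (D / x)).
  { intros D x Hx HD. apply Rplus_le_compat_l, Ropp_le_contravar.
    rewrite <- (sqrt_pow2 (vol W)) at 1 by lra. rewrite <- sqrt_mult_alt by lra.
    apply sqrt_le_1_alt.
    replace ((vol W * Q_h E q W) ^ 2 + 2 * vol W ^ 2 * M)
      with (vol W ^ 2 * (Q_h E q W ^ 2 + 2 * M)) by ring.
    apply Rmult_le_compat_l; [lra|]. apply Rmult_le_reg_r with x; [assumption|].
    replace (D / x * x) with D by (field; lra). assumption. }
  unfold head_speed. destruct (kind w 0) eqn:Hkind.
  - destruct (lw_shock E w W Ws Hw 0 Hlen Hkind) as [[Hne Hhug] _].
    rewrite (lw_first E w W Ws Hw) in *.
    unfold sigma, Q_S. pose proof (proj2 Hhug) as Hvel.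
    destruct Hce as [Hc|He].
    + destruct (Hc 0%nat Hlen) as [HP Hvv]. rewrite (lw_first E w W Ws Hw) in *.
      destruct (compressive_tail w W Ws 1 Hw Hc Hlen) as [Hve Hpr].
      pose proof (compressive_pres _ _ HW HW1 HP Hvv) as Hpp.
      rewrite f_S_compressive in Hvel by assumption.
      rewrite !Rabs_pos_eq by lra.
      apply Hslope; [lra|].
      apply compressive_shock_slope; try assumption; [lra| |].
      * intros t Ht. apply HM. lra.
      * destruct Hcomp as [Hco|Hco]; [left|right; lra].
        apply le_of_sqrt_le with (vel W - vel (st w 1)); [apply Rmult_le_pos; lra|lra|lra].
    + destruct (He 0%nat Hlen) as [HP Hvv]. rewrite (lw_first E w W Ws Hw) in *.
      destruct (expansive_tail w W Ws 1 Hw He Hlen) as [Hve Hpr].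
      pose proof (compressive_pres _ _ HW1 HW HP Hvv) as Hpp.
      rewrite f_S_expansive in Hvel by assumption.
      rewrite (Rabs_minus_sym (pres _)), (Rabs_minus_sym (vol _)), !Rabs_pos_eq by lra.
      apply Hslope; [lra|].
      (* The sonic slope is exchanged for [Q_h] at the compressive pressure [q], which dominates it
         by [Hsound]. *)
      apply Rle_trans with ((sound W / vol W ^ 2 + 2 * M) * (vol (st w 1) - vol W)).
      * apply expansive_shock_slope with q'; try assumption; [lra| |].
        -- intros t Ht. apply HM. lra.
        -- destruct Hexp as [Hex|Hex]; [left|right; lra].
           apply le_of_sqrt_le with (vel (st w 1) - vel W); [apply Rmult_le_pos; lra|lra|lra].
      * apply Rmult_le_compat_r; [lra|]. apply Rplus_le_compat_r.
        apply Rmult_le_reg_l with (vol W ^ 2); [assumption|].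
        replace (vol W ^ 2 * (sound W / vol W ^ 2)) with (sound W) by (field; lra).
        rewrite <- Rpow_mult_distr. assumption.
  - rewrite (lw_first E w W Ws Hw). unfold lambda.
    apply Rplus_le_compat_l, Ropp_le_contravar, sqrt_le_1_alt.
    unfold c2. change (a_h2 E (vol W) (sh E W)) with (sound W).
    (* For a fan only the initial volume matters. It lies in the range of [M], and a single [M]
       already bounds the binding part of the characteristic speed. *)
    specialize (HM (vol W) ltac:(lra)).
    pose proof (a_b2_hat_nonneg (vol W) Hv).
    apply Rmult_le_compat_l with (r := vol W ^ 2) in HM; [|lra].
    replace (vol W ^ 2 * (a_b2_hat E (vol W) / vol W ^ 2)) with (a_b2_hat E (vol W)) in HM
      by (field; lra).
    lra.
Qed.

(** * From the initial data to the speed bounds *)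

Lemma f_S_h_nonneg (W : state) (P : R) :
  admissible E W -> - p_inf E < P -> 0 <= f_S_h E P W ->
  ph E W <= P /\ f_S_h E P W = sqrt ((P - ph E W) * (vol W - xi_h E P W)).
Proof.
  intros HW HP Hf. unfold f_S_h in *.
  destruct (Rtotal_order P (ph E W)) as [Hlt|[->|Hgt]].
  - exfalso. pose proof (xi_h_expansion W P HW HP Hlt).
    rewrite sign_eq_m1 in Hf by lra.
    assert (0 < sqrt (Rabs (P - ph E W))) by (apply sqrt_lt_R0, Rabs_pos_lt; lra).
    assert (0 < sqrt (Rabs (vol W - xi_h E P W))) by (apply sqrt_lt_R0, Rabs_pos_lt; lra).
    assert (0 < sqrt (Rabs (P - ph E W)) * sqrt (Rabs (vol W - xi_h E P W)))
      by now apply Rmult_lt_0_compat.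
    lra.
  - split; [apply Rle_refl|]. rewrite Rminus_diag, sign_0, !Rmult_0_l. now rewrite sqrt_0.
  - split; [lra|]. pose proof (xi_h_compression W P HW Hgt).
    rewrite sign_eq_1, !Rabs_pos_eq, sqrt_mult by lra. ring.
Qed.

Lemma f_S_h_nonpos (W : state) (P : R) :
  admissible E W -> - p_inf E < P -> f_S_h E P W <= 0 ->
  P <= ph E W /\ - f_S_h E P W = sqrt ((ph E W - P) * (xi_h E P W - vol W)).
Proof.
  intros HW HP Hf. unfold f_S_h in *.
  destruct (Rtotal_order P (ph E W)) as [Hlt|[->|Hgt]].
  - split; [lra|]. pose proof (xi_h_expansion W P HW HP Hlt).
    rewrite sign_eq_m1, (Rabs_minus_sym P), (Rabs_minus_sym (vol W)), !Rabs_pos_eq, sqrt_mult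
      by lra. ring.
  - split; [apply Rle_refl|]. rewrite Rminus_diag, sign_0, !Rmult_0_l, sqrt_0. ring.
  - exfalso. pose proof (xi_h_compression W P HW Hgt).
    rewrite sign_eq_1 in Hf by lra.
    assert (0 < sqrt (Rabs (P - ph E W))) by (apply sqrt_lt_R0, Rabs_pos_lt; lra).
    assert (0 < sqrt (Rabs (vol W - xi_h E P W))) by (apply sqrt_lt_R0, Rabs_pos_lt; lra).
    assert (0 < sqrt (Rabs (P - ph E W)) * sqrt (Rabs (vol W - xi_h E P W)))
      by now apply Rmult_lt_0_compat.
    lra.
Qed.

Lemma a_b2_hat_max (a b : R) :
  0 < a <= b -> exists M, is_max_on (fun t => a_b2_hat E t / t ^ 2) a b M.
Proof.
  intros Hab.
  destruct (continuity_ab_maj (fun t => a_b2_hat E t / t ^ 2) a b ltac:(lra)) as (t & Ht & Hin).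
  - intros c Hc. apply ex_derive_continuity_pt.
    pose proof (a_b2_hat_ex_derive c ltac:(lra)). auto_derive.
    split; [assumption|]. split; [|exact I]. apply Rgt_not_eq. nra.
  - exists (a_b2_hat E t / t ^ 2). split; [now exists t|exact Ht].
Qed.

(* The opposite wave [w'] is taken mirrored, hence the signs of its velocities. *)
Lemma one_sided_bound (w w' : wave) (W W' Ws Ws' : state) (qbar qund : R) :
  left_wave E w W Ws -> left_wave E w' W' Ws' ->
  compressive E w \/ expansive E w -> compressive E w' \/ expansive E w' ->
  vel Ws = - vel Ws' -> pres Ws = pres Ws' ->
  - p_inf E < qbar -> f_S_h E qbar W = Rmax (vel W + vel W') 0 ->
  - p_inf E < qund -> f_S_h E qund W = Rmin (vel W + vel W') 0 ->
  let Pbar := Rmax qbar (pres W' - p_b_hat E (vol W)) in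
  let Pund := Rmin qund (pres W' - p_b_hat E (vol W)) in
  - p_inf E < Pund ->
  qund <= ph E W <= qbar /\ xi_h E Pbar W <= vol W <= xi_h E Pund W /\
  exists M, is_max_on (fun t => a_b2_hat E t / t ^ 2) (xi_h E Pbar W) (xi_h E Pund W) M /\
    vel W - sqrt ((vol W * Q_h E Pbar W) ^ 2 + 2 * vol W ^ 2 * M) <= head_speed E w 0.
Proof.
  intros Hw Hw' Hce Hce' Hvs Hps Hqb Hfb Hqu Hfu Pbar Pund HPund.
  assert (HW : admissible E W).
  { rewrite <- (lw_first E w W Ws Hw). apply (lw_admissible E w W Ws Hw). lia. }
  pose proof HW as [_ HP0].
  destruct (f_S_h_nonneg W qbar HW Hqb) as [Hq1 Hf1]; [rewrite Hfb; apply Rmax_r|].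
  destruct (f_S_h_nonpos W qund HW Hqu) as [Hq2 Hf2]; [rewrite Hfu; apply Rmin_r|].
  assert (Hb1 : qbar <= Pbar) by apply Rmax_l.
  assert (Hb2 : pres W' - p_b_hat E (vol W) <= Pbar) by apply Rmax_r.
  assert (Hu1 : Pund <= qund) by apply Rmin_l.
  assert (Hu2 : Pund <= pres W' - p_b_hat E (vol W)) by apply Rmin_r.
  pose proof (xi_h_below W qbar Pbar HW Hqb Hb1) as Hxb.
  pose proof (xi_h_below W Pund qund HW HPund Hu1) as Hxu.
  pose proof (xi_h_below W _ _ HW HP0 Hq1) as Hxq.
  pose proof (xi_h_below W _ _ HW Hqu Hq2) as Hxq'.
  rewrite (xi_h_self W HW) in Hxq, Hxq'.
  split; [lra|]. split; [lra|].
  destruct (xi_h_spec W Pbar HW ltac:(lra)) as [Hpos _].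
  destruct (a_b2_hat_max (xi_h E Pbar W) (xi_h E Pund W)) as [M HM]; [lra|].
  exists M. split; [exact HM|].
  assert (HW0 : pres W = ph E W + p_b_hat E (vol W)) by apply pres_ph.
  pose proof (Rmax_l (vel W + vel W') 0). pose proof (Rmin_l (vel W + vel W') 0).
  apply left_wave_speed with Ws Pund; try assumption; [lra|apply HM| |].
  (* Mirrored velocities decrease along a compressive opposite wave, so [vel Ws] is at least
     [- vel W'], which leads to [qbar]. Along an expansive one [pres Ws] is at most [pres W'], which
     leads to the other argument of [Pbar]. The lower bounds follow with the roles exchanged. *)
  - destruct Hce' as [Hc|He].
    + left. destruct (compressive_tail w' W' Ws' 0 Hw' Hc ltac:(lia)) as [Hv _].
      rewrite (lw_first E w' W' Ws' Hw') in Hv.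
      apply Rle_trans with (f_S_h E qbar W); [lra|]. rewrite Hf1. apply sqrt_le_1_alt.
      apply Rmult_le_compat; lra.
    + right. destruct (expansive_tail w' W' Ws' 0 Hw' He ltac:(lia)) as [_ Hp].
      rewrite (lw_first E w' W' Ws' Hw') in Hp. lra.
  - destruct Hce' as [Hc|He].
    + right. destruct (compressive_tail w' W' Ws' 0 Hw' Hc ltac:(lia)) as [_ Hp].
      rewrite (lw_first E w' W' Ws' Hw') in Hp. lra.
    + left. destruct (expansive_tail w' W' Ws' 0 Hw' He ltac:(lia)) as [Hv _].
      rewrite (lw_first E w' W' Ws' Hw') in Hv.
      apply Rle_trans with (- f_S_h E qund W); [lra|]. rewrite Hf2. apply sqrt_le_1_alt.
      apply Rmult_le_compat; lra.
Qed.

End Equation_of_state.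

Theorem theorem2p1 :
  forall (E : eos) (WL WR : state) (wL wR : wave)
    (qbarL qbarR qundL qundR : R),
  complete_eos E -> hydro_convexity E -> hydro_energy E -> binding_eos E ->
  xi_h_decreasing E ->
  hydro_riemann_solvable E WL WR ->
  riemann_solution E WL WR wL wR ->
  compressive E wL \/ expansive E wL ->
  compressive E wR \/ expansive E wR ->
  unique (fun P => - p_inf E < P /\
            f_S_h E P WL = Rmax (vel WL - vel WR) 0) qbarL ->
  unique (fun P => - p_inf E < P /\
            f_S_h E P WR = Rmax (vel WL - vel WR) 0) qbarR ->
  unique (fun P => - p_inf E < P /\
            f_S_h E P WL = Rmin (vel WL - vel WR) 0) qundL ->
  unique (fun P => - p_inf E < P /\
            f_S_h E P WR = Rmin (vel WL - vel WR) 0) qundR ->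
  let PbarL := Rmax qbarL (pres WR - p_b_hat E (vol WL)) in
  let PbarR := Rmax qbarR (pres WL - p_b_hat E (vol WR)) in
  let PundL := Rmin qundL (pres WR - p_b_hat E (vol WL)) in
  let PundR := Rmin qundR (pres WL - p_b_hat E (vol WR)) in
  (* xi_h is defined at the lower pressure bounds *)
  - p_inf E < PundL -> - p_inf E < PundR ->
  let vbarL := xi_h E PbarL WL in
  let vbarR := xi_h E PbarR WR in
  let vundL := xi_h E PundL WL in
  let vundR := xi_h E PundR WR in
  let lambda1h := vel WL - vol WL * Q_h E PbarL WL in
  let lambda3h := vel WR + vol WR * Q_h E PbarR WR in
  (qundL <= ph E WL <= qbarL) /\ (qundR <= ph E WR <= qbarR) /\
  (vbarL <= vol WL <= vundL) /\ (vbarR <= vol WR <= vundR) /\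
  (exists M : R,
     is_max_on (fun t => a_b2_hat E t / t ^ 2) vbarL vundL M /\
     lambda_1_minus E wL >=
       vel WL - sqrt ((vel WL - lambda1h) ^ 2 + 2 * vol WL ^ 2 * M)) /\
  (exists M : R,
     is_max_on (fun t => a_b2_hat E t / t ^ 2) vbarR vundR M /\
     lambda_3_plus E wR <=
       vel WR + sqrt ((lambda3h - vel WR) ^ 2 + 2 * vol WR ^ 2 * M)).
Proof.
  intros E WL WR wL wR qbarL qbarR qundL qundR HE Hconvex Henergy Hbind Hxi _
    (WsL & WsR & HwL & HwR & Hvel & Hpres) HceL HceR
    [[HqbL HfbL] _] [[HqbR HfbR] _] [[HquL HfuL] _] [[HquR HfuR] _]
    PbarL PbarR PundL PundR HPL HPR vbarL vbarR vundL vundR lambda1h lambda3h.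
  destruct (one_sided_bound E HE Hconvex Henergy Hxi Hbind wL (mirror_wave wR)
    WL (mirror WR) WsL (mirror WsR) qbarL qundL)
    as (HqL & HvL & ML & HML & HspeedL); try assumption.
  { simpl. lra. }
  (* Mirroring changes only the velocity, so [vol], [xi_h] and [Q_h] at [mirror WR] are convertible
     to those at [WR]; the velocity sum is again [vel WL - vel WR] up to commutativity. *)
  destruct (one_sided_bound E HE Hconvex Henergy Hxi Hbind (mirror_wave wR) wL
    (mirror WR) WL (mirror WsR) WsL qbarR qundR)
    as (HqR & HvR & MR & HMR & HspeedR); try assumption.
  { simpl. lra. }
  { symmetry. assumption. }
  { simpl. rewrite Rplus_comm. exact HfbR. }
  { simpl. rewrite Rplus_comm. exact HfuR. }
  split; [exact HqL|]. split; [exact HqR|]. split; [exact HvL|]. split; [exact HvR|].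
  split.
  - exists ML. split; [exact HML|]. apply Rle_ge.
    replace (vel WL - lambda1h) with (vol WL * Q_h E PbarL WL) by (unfold lambda1h; ring).
    exact HspeedL.
  - exists MR. split; [exact HMR|].
    replace (lambda3h - vel WR) with (vol WR * Q_h E PbarR WR) by (unfold lambda3h; ring).
    unfold lambda_3_plus. apply Ropp_le_contravar in HspeedR.
    eapply Rle_trans; [exact HspeedR|].
    change (- (- vel WR - sqrt ((vol WR * Q_h E PbarR WR) ^ 2 + 2 * vol WR ^ 2 * MR))
      <= vel WR + sqrt ((vol WR * Q_h E PbarR WR) ^ 2 + 2 * vol WR ^ 2 * MR)).
    lra.
Qed.
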